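(* Let $\alpha$ be a probability on $\mathbb{R}^d$ such that $\int_{\mathbb{R}^d}\|x\|\,\alpha(dx)<\infty$. Then for every convex function $\psi:\mathbb{R}^d\to\mathbb{R}$ and for all $0<s\le t$, $$\int_{\mathbb{R}^d}\psi(x)\,\mu(t\alpha)(dx)\le \int_{\mathbb{R}^d}\psi(x)\,\mu(s\alpha)(dx).$$ In other terms, $t\mapsto\mu(t\alpha)$ is decreasing on $(0,\infty)$ for the Strassen convex order.
   Context: For a probability $\alpha$ on $\mathbb{R}^d$ with $\int\log(1+\|x\|)\alpha(dx)<\infty$ and $t>0$, let $B_1,Y_1,B_2,Y_2,\ldots$ be independent with $B_n\sim\alpha$ and $Y_n\sim\beta(1,t)$ (density $t(1-y)^{t-1}$ on $(0,1)$), and put $W_1=Y_1$, $W_n=Y_n(1-Y_{n-1})\cdots(1-Y_1)$ for $n>1$. The random probability $P_t=\sum_{n\ge1}W_n\delta_{B_n}$ is a Dirichlet random probability, $P_t\sim\mathcal{D}(t\alpha)$ (for every measurable partition $(A_0,\dots,A_k)$ of $\mathbb{R}^d$ the vector $(P_t(A_0),\dots,P_t(A_k))$ is Dirichlet distributed with parameters $(t\alpha(A_0),\dots,t\alpha(A_k))$). Then $X_t=\int_{\mathbb{R}^d} x\,P_t(dx)=\sum_{n\ge1}W_nB_n$ converges absolutely almost surely, and $\mu(t\alpha)$ denotes its distribution. Strassen convex order: for probabilities $\mu,\nu$ on $\mathbb{R}^d$ having means, $\nu\prec\mu$ means $\int\psi\,d\nu\le\int\psi\,d\mu$ for all convex $\psi:\mathbb{R}^d\to\mathbb{R}$.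 If $\mu$ has a mean, the negative part of a convex $\psi$ is $\mu$-integrable, so $\int\psi\,d\mu\in(-\infty,+\infty]$ makes sense. If $\int\|x\|\alpha(dx)<\infty$ then $\mu(t\alpha)$ has a mean for every $t>0$. *)

(* Defs.v *)
From HB Require Import structures.
From mathcomp Require Import all_boot all_order all_algebra finmap.
From mathcomp Require Import all_classical all_reals all_analysis.
Set Implicit Arguments.
Unset Strict Implicit.
Unset Printing Implicit Defensive.
Import Order.TTheory GRing.Theory Num.Theory.
Import numFieldNormedType.Exports.
Local Open Scope classical_set_scope.
Local Open Scope ring_scope.

(* R^d is ['rV[R]_d] with its Borel sigma-algebra: the one generated by the
   open sets of the library topology on matrices, i.e. the product topology. *)
HB.instance Definition _ (R : realType) (d : nat) :=
  Measurable.copy 'rV[R]_d (g_sigma_algebraType (@open 'rV[R]_d)).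

(* The library norm on ['rV[R]_d] is the sup norm. *)
Definition enorm (R : realType) (d : nat) (x : 'rV[R]_d) : R :=
  Num.sqrt (\sum_(i < d) (x 0 i) ^+ 2).

Definition has_mean (R : realType) (d : nat) (nu : probability 'rV[R]_d R) :=
  (\int[nu]_x (enorm x)%:E < +oo)%E.

Definition convexRd (R : realType) (d : nat) (psi : 'rV[R]_d -> R) :=
  convex_function [set: convex_lmodType 'rV[R]_d] psi.

(* For convex [psi] and [nu] having a mean, the negative part of [psi] is
   integrable, so the extended integrals below lie in ]-oo, +oo]. *)
Definition strassen_le (R : realType) (d : nat)
    (nu mu : probability 'rV[R]_d R) :=
  [/\ has_mean nu, has_mean mu &
   forall psi : 'rV[R]_d -> R, convexRd psi ->
     (\int[nu]_x (psi x)%:E <= \int[mu]_x (psi x)%:E)%E].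

(* [nu] is a plain set function, only its values on measurable sets matter. *)
Definition has_law (dO dT : measure_display) (Omega : measurableType dO)
    (T : measurableType dT) (R : realType) (P : probability Omega R)
    (X : {RV P >-> T}) (nu : set T -> \bar R) :=
  forall A : set T, measurable A -> distribution P X A = nu A.

Definition mutually_independent (dO : measure_display)
    (Omega : measurableType dO) (R : realType) (P : probability Omega R)
    (I : choiceType) (F : I -> set (set Omega)) :=
  forall (J : {fset I}) (A : I -> set Omega),
    (forall i, i \in J -> F i (A i)) ->
    P (\bigcap_(i in [set` J]) A i) = (\prod_(i <- J) P (A i))%E.

Definition sigma_RV (dO dT : measure_display) (Omega : measurableType dO)
    (T : measurableType dT) (R : realType) (P : probability Omega R)
    (X : {RV P >-> T}) : set (set Omega) :=
  preimage_set_system setT X measurable.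

(* beta(1, t) for real t > 0; the library [beta_prob] only has parameters
   in nat. *)
Definition beta1_pdf (R : realType) (t y : R) : R :=
  if (0 < y) && (y < 1) then t * (1 - y) `^ (t - 1) else 0.

Definition beta1 (R : realType) (t : R) (A : set R) : \bar R :=
  (\int[lebesgue_measure]_(y in A) (beta1_pdf t y)%:E)%E.

(* The indices of [B], [Y] and the weights are shifted by one: they start
   at 0. *)
Definition stick_weight (Omega : Type) (R : realType) (Y : nat -> Omega -> R)
    (n : nat) (w : Omega) : R :=
  Y n w * \prod_(i < n) (1 - Y i w).

(* [X] is a version of X_t = \sum_n W_n B_n = \int x P_t(dx), where
   P_t = \sum_n W_n \delta_(B_n) ~ D(t alpha). *)
Definition dirichlet_mean (dO : measure_display) (Omega : measurableType dO)
    (R : realType) (P : probability Omega R) (d : nat)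
    (alpha : probability 'rV[R]_d R) (t : R)
    (B : nat -> {RV P >-> 'rV[R]_d}) (Y : nat -> {RV P >-> R})
    (X : {RV P >-> 'rV[R]_d}) :=
  [/\ forall n, has_law (B n) alpha,
      forall n, has_law (Y n) (beta1 t),
      mutually_independent P
        (fun k : nat + nat => match k with
         | inl n => sigma_RV (B n)
         | inr n => sigma_RV (Y n)
         end) &
      {ae P, forall w,
        series (fun n => stick_weight Y n w *: B n w) @ \oo --> X w}].

(* [mu] is the probability mu(t alpha). *)
Definition is_dirichlet_mean_law (R : realType) (d : nat)
    (alpha : probability 'rV[R]_d R) (t : R) (mu : probability 'rV[R]_d R) :=
  exists (dO : measure_display) (Omega : measurableType dO)
    (P : probability Omega R) (B : nat -> {RV P >-> 'rV[R]_d})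
    (Y : nat -> {RV P >-> R}) (X : {RV P >-> 'rV[R]_d}),
    dirichlet_mean alpha t B Y X /\ has_law X mu.

(* Main.v *)
From HB Require Import structures.
Require Import Defs.
From mathcomp Require Import all_boot all_order all_algebra finmap.
From mathcomp Require Import all_classical all_reals all_analysis.
From mathcomp Require Import measurable_realfun ring lra.
Set Implicit Arguments.
Unset Strict Implicit.
Unset Printing Implicit Defensive.
Import Order.TTheory GRing.Theory Num.Theory.
Import numFieldNormedType.Exports.
Local Open Scope classical_set_scope.
Local Open Scope ring_scope.

(* Let [T_t G x = E G ((1 - Y) x + Y B)] with [Y ~ beta(1, t)] and [B ~ alpha]
   independent. If [S_n] is the [n]-th partial sum of [\sum_k W_k B_k] and [Pi_n]
   the part of the stick left after [n] breaks, then
   [E G (S_n + Pi_n x) = T_t^n G x], so that for Lipschitz [G] the iterates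
   [T_t^n G x] tend to [\int G d mu(t alpha)]; in particular [mu(t alpha)] is
   invariant under [T_t].
   For convex [G] put [g y = \int\int G ((1 - y) x + y b) alpha(db) mu(s alpha)(dx)].
   This function is convex and [\int g d beta(1, s) = g 0] by invariance, hence
   [g - g 0] is first nonpositive and then nonnegative. For [s <= t] the density
   of [beta(1, t)] with respect to [beta(1, s)] is nonincreasing, whence
   [\int g d beta(1, t) <= g 0], that is
   [\int T_t G d mu(s alpha) <= \int G d mu(s alpha)]. As [T_t] preserves
   convexity, iterating and letting [n] tend to infinity gives the theorem for
   nonnegative Lipschitz convex functions. Inf-convolutions and truncation from
   below extend it to all convex functions. *)

(** * Borel measurability on row vectors *)

Section row_vectors.
Context {R : realType} {d : nat}.
Implicit Types x y : 'rV[R]_d.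

Lemma rV_norm_leP x (e : R) : 0 <= e ->
  (`|x| <= e) <-> forall i, `|x 0 i| <= e.
Proof.
move=> e0; rewrite /Num.norm/= mx_normrE; split=> [/bigmax_leP[_ H] i|H].
  exact: (H (0, i)).
by apply/bigmax_leP; split=> // -[i j] _; rewrite (ord1 i); exact: H.
Qed.

Lemma coord_le_norm x i : `|x 0 i| <= `|x|.
Proof. by move: i; apply/rV_norm_leP. Qed.

Lemma continuous_measurable_rV (f : 'rV[R]_d -> R) :
  continuous f -> measurable_fun setT f.
Proof.
move=> /continuousP cf; apply: (measurability _ (RGenOpens.measurableE R)).
move=> _ [_ [a [b ->] <-]]; rewrite setTI.
by apply: sub_sigma_algebra; exact/cf/interval_open.
Qed.

Lemma measurable_coord i : measurable_fun setT (fun x => x 0 i).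
Proof.
exact: (continuous_measurable_rV (@coord_continuous _ _ _ 0 i)).
Qed.

(** Rational vectors are dense: a ball of radius [r < e / 2] about a rational point at distance less
    than [r] from [x] contains [x] and stays in the [e]-ball of [x]. Rational centres and radii
    [1 / (k + 1)] make the family countable. *)
Lemma open_bigcup_rat_ball (U : set 'rV[R]_d) : open U ->
  U = \bigcup_(p in [set p : 'rV[rat]_d * nat |
        ball (map_mx ratr p.1 : 'rV[R]_d) p.2.+1%:R^-1 `<=` U])
      ball (map_mx ratr p.1 : 'rV[R]_d) p.2.+1%:R^-1.
Proof.
move=> oU; apply/seteqP; split=> [x Ux|x [p /=]]; last exact.
have /nbhs_ballP[e /= e0 eU] := open_nbhs_nbhs (conj oU Ux).
have [k /= ke] : exists k : nat, k.+1%:R^-1 < e / 2.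
  have /cvgrPdist_lt/(_ (e / 2)) : @harmonic R @ \oo --> 0 by exact: cvg_harmonic.
  rewrite divr_gt0// => /(_ isT)[k _ /(_ k (leqnn _))] /=.
  by rewrite sub0r normrN ger0_norm ?invr_ge0//; exists k.
set r : R := k.+1%:R^-1; have r0 : 0 < r by rewrite invr_gt0.
have qP i : exists q : rat, `|ratr q - x 0 i| < r.
  have /rat_in_itvoo[q] : x 0 i - r < x 0 i + r.
    by rewrite ltrBlDr -addrA ltrDl addr_gt0.
  by rewrite in_itv/= => H; exists q; rewrite distrC ltr_distlC.
have [q Hq] := choice qP.
have Hx : ball (map_mx ratr (\row_i q i) : 'rV[R]_d) r x.
  by split=> // i j; rewrite /ball/= !mxE (ord1 i).
exists (\row_i q i, k) => //= y Hy; apply: eU.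
rewrite (splitr e).
apply: (@ball_triangle _ _ (map_mx ratr (\row_i q i) : 'rV[R]_d)).
  by apply: ball_sym; apply: le_ball Hx; exact: ltW.
by apply: le_ball Hy; exact: ltW.
Qed.

(** The sigma-algebra on row vectors is generated by open sets and not built as a product. An open
    set is a countable union of sup-norm balls, and each ball is a finite intersection of conditions
    on single coordinates. *)
Lemma measurable_fun_rV d' (T : measurableType d') (f : T -> 'rV[R]_d) :
  (forall i, measurable_fun setT (fun w => f w 0 i)) -> measurable_fun setT f.
Proof.
move=> mf; refine (@measurability _ _ T 'rV[R]_d _ f (@open 'rV[R]_d) erefl _).
move=> _ [U oU <-]; rewrite setTI (open_bigcup_rat_ball oU) preimage_bigcup.
rewrite bigcup_mkcond; apply: countable_bigcupT_measurable.
  exact: countableP.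
move=> [q k]; case: ifPn => // _.
rewrite (_ : _ @^-1` _ = \bigcap_(i in [set: 'I_d])
    ((fun w => f w 0 i) @^-1` ball (ratr (q 0 i) : R) k.+1%:R^-1)).
  apply: fin_bigcap_measurable; first exact: finite_finset.
  move=> i _; rewrite -[X in measurable X]setTI; apply: mf => //.
  by apply: open_measurable; exact: ball_open.
apply/seteqP; split=> w /=.
  by move=> [_ H] i _; move: (H 0 i); rewrite mxE.
move=> H; split=> [|i j]; first by rewrite invr_gt0.
by rewrite mxE (ord1 i); exact: H.
Qed.

Lemma measurable_fun_addrV d' (T : measurableType d') (f g : T -> 'rV[R]_d) :
  measurable_fun setT f -> measurable_fun setT g ->
  measurable_fun setT (fun w => f w + g w).
Proof.
move=> mf mg; apply: measurable_fun_rV => i.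
under eq_fun do rewrite mxE.
by apply: measurable_funD;
  apply: (measurableT_comp (measurable_coord i)).
Qed.

Lemma measurable_fun_scalerV d' (T : measurableType d') (f : T -> R)
    (g : T -> 'rV[R]_d) :
  measurable_fun setT f -> measurable_fun setT g ->
  measurable_fun setT (fun w => f w *: g w).
Proof.
move=> mf mg; apply: measurable_fun_rV => i.
under eq_fun do rewrite mxE.
apply: measurable_funM => //.
exact: (measurableT_comp (measurable_coord i)).
Qed.

Lemma measurable_normrV : measurable_fun setT (fun x : 'rV[R]_d => `|x|).
Proof. by apply: continuous_measurable_rV => x; exact: norm_continuous. Qed.

Lemma norm_le_enorm x : `|x| <= enorm x.
Proof.
apply/rV_norm_leP => [|i]; first exact: sqrtr_ge0.
rewrite -sqrtr_sqr ler_wsqrtr// (bigD1 i)//= lerDl.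
by apply: sumr_ge0 => j _; exact: sqr_ge0.
Qed.

(** Summing [d] squares gives the factor [sqrt d], rounded up to [d]: only finiteness of means is to
    pass between the two norms. *)
Lemma enorm_le_norm x : enorm x <= d%:R * `|x|.
Proof.
rewrite -(@ler_pXn2r _ 2) ?nnegrE ?sqrtr_ge0 ?mulr_ge0//.
rewrite sqr_sqrtr; last by apply: sumr_ge0 => i _; exact: sqr_ge0.
apply: (@le_trans _ _ (\sum_(i < d) `|x| ^+ 2)).
  apply: ler_sum => i _; rewrite -(real_normK (num_real (x 0 i))).
  by rewrite ler_pXn2r ?nnegrE// coord_le_norm.
rewrite sumr_const card_ord exprMn -[leLHS]mulr_natl ler_wpM2r ?exprn_ge0//.
by rewrite -natrX ler_nat; case: (d) => // n; rewrite -mulnn leq_pmulr.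
Qed.

Lemma measurable_enorm : measurable_fun setT (@enorm R d).
Proof.
apply: measurableT_comp => //.
  exact: (continuous_measurable_fun (@sqrt_continuous R)).
apply: measurable_sum => i; apply: measurable_funX.
exact: measurable_coord.
Qed.

End row_vectors.

(** * Independence of the past and the present *)

Section independence.
Context (dO : measure_display) (Omega : measurableType dO) (R : realType)
  (P : probability Omega R).

(** Measurable rectangles are stable under intersection and generate the product sigma-algebra. *)
Lemma finite_measure_prod_ext d1 d2 (T1 : measurableType d1)
    (T2 : measurableType d2) (m1 m2 : {measure set (T1 * T2) -> \bar R}) :
  (m1 setT < +oo)%E ->
  (forall A B, measurable A -> measurable B -> m1 (A `*` B) = m2 (A `*` B)) ->
  forall X, measurable X -> m1 X = m2 X.
Proof.
move=> m1oo m12; pose C : set (set (T1 * T2)) :=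
  [set A `*` B | A in measurable & B in measurable].
apply: (measure_unique C (fun=> setT)) => //.
- exact: measurable_prod_measurableType.
- move=> _ _ [X1 mX1 [X2 mX2 <-]] [Y1 mY1 [Y2 mY2 <-]].
  rewrite -setXI; exists (X1 `&` Y1); first exact: measurableI.
  by exists (X2 `&` Y2) => //; exact: measurableI.
- by move=> _; exists setT => //; exists setT => //; rewrite setXTT.
- by rewrite bigcup_const.
- by move=> _ [A mA [B mB <-]]; exact: m12.
Qed.

(** Both sides are measures in [D]: the restriction of [P] to [E] pushed forward by [V], and [c]
    times the law of [V]. Agreement on rectangles therefore suffices. *)
Lemma probability_setI_prod d1 d2 (T1 : measurableType d1)
    (T2 : measurableType d2) (V : Omega -> T1 * T2)
    (E : set Omega) (c : \bar R) :
  measurable_fun setT V -> (0 <= c)%E -> c \is a fin_num -> measurable E ->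
  (forall A B, measurable A -> measurable B ->
    P (V @^-1` (A `*` B) `&` E) = (c * P (V @^-1` (A `*` B)))%E) ->
  forall D, measurable D -> P (V @^-1` D `&` E) = (c * P (V @^-1` D))%E.
Proof.
move=> mV c0 cfin mE H D mD; have c0' := fine_ge0 c0.
pose m1 : {measure set _ -> \bar R} := pushforward (mrestr P mE) V.
pose m2 : {measure set _ -> \bar R} := mscale (NngNum c0') (pushforward P V).
rewrite -[c]fineK// in H *; rewrite -[LHS]/(m1 mV D) -[RHS]/(m2 mV D).
apply: finite_measure_prod_ext => //.
rewrite /m1/= /pushforward/= /mrestr preimage_setT setTI.
by rewrite (le_lt_trans (probability_le1 _ _)) ?ltry.
Qed.

End independence.

Definition time_index (k : nat + nat) : nat :=
  match k with inl n => n | inr n => n end.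

Section independent_sequences.
Context (dO : measure_display) (Omega : measurableType dO) (R : realType)
  (P : probability Omega R) (d1 d2 : measure_display)
  (T1 : measurableType d1) (T2 : measurableType d2)
  (B : nat -> {RV P >-> T1}) (Y : nat -> {RV P >-> T2}).

Let sigma_BY (k : nat + nat) : set (set Omega) :=
  match k with inl n => sigma_RV (B n) | inr n => sigma_RV (Y n) end.

Hypothesis indBY : mutually_independent P sigma_BY.

Let measurable_sigma_BY k E : sigma_BY k E -> measurable E.
Proof.
by case: k => k [A mA <-]; exact: measurable_funP.
Qed.

(** Finite intersections stand in for the sigma-algebra that they generate: mutual independence
    applies to them directly. *)
Definition future_cylinder (n : nat) (E : set Omega) :=
  exists (J : {fset (nat + nat)}) (A : nat + nat -> set Omega),
    [/\ forall i, i \in J -> (n <= time_index i)%N,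
        forall i, i \in J -> sigma_BY i (A i) &
        E = \bigcap_(i in [set` J]) A i].

Lemma future_cylinder_measurable n E : future_cylinder n E -> measurable E.
Proof.
move=> [J [A [_ AJ ->]]]; apply: fin_bigcap_measurable => // i iJ.
exact/measurable_sigma_BY/AJ.
Qed.

Lemma future_cylinderT n : future_cylinder n setT.
Proof.
exists fset0, (fun=> setT); split=> //.
by rewrite (_ : [set` fset0] = set0) ?bigcap_set0//; apply/seteqP; split.
Qed.

(** Mutual independence is applied to [J] with and without [i]; the two products differ by the
    factor of [i]. The value of [A] at [i] is arbitrary, whence the modified family. *)
Lemma independent_cylinderU1 (i : nat + nat) (J : {fset (nat + nat)})
    (A : nat + nat -> set Omega) (E : set Omega) :
  i \notin J -> (forall i, i \in J -> sigma_BY i (A i)) -> sigma_BY i E ->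
  exists A' : nat + nat -> set Omega,
    [/\ forall j, j \in (i |` J)%fset -> sigma_BY j (A' j),
      E `&` \bigcap_(j in [set` J]) A j =
        \bigcap_(j in [set` (i |` J)%fset]) A' j &
      P (E `&` \bigcap_(j in [set` J]) A j) =
        (P E * P (\bigcap_(j in [set` J]) A j))%E].
Proof.
move=> iJ AJ Ei; pose A' j := if j == i then E else A j.
have A'J j : j \in (i |` J)%fset -> sigma_BY j (A' j).
  by rewrite !inE /A'; case: eqVneq => [->|_] //= /AJ.
have A'E j : j \in J -> A' j = A j.
  by rewrite /A'; case: eqVneq => // -> /(negP iJ).
have HE : E `&` \bigcap_(j in [set` J]) A j =
    \bigcap_(j in [set` (i |` J)%fset]) A' j.
  apply/seteqP; split=> [w [Ew Aw] j /=|w H].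
    rewrite !inE => /orP[/eqP->|jJ]; first by rewrite /A' eqxx.
    by rewrite A'E//; exact: Aw.
  split; first by have := H i; rewrite /= !inE /A' eqxx; exact.
  by move=> j /= jJ; have := H j; rewrite /= A'E// !inE jJ orbT; exact.
exists A'; split => //.
rewrite HE indBY// big_fsetU1//= {1}/A' eqxx indBY//; congr (_ * _)%E.
by rewrite !big_seq; apply: eq_bigr => j jJ; rewrite A'E.
Qed.

(** Both indices of time [n] are absent from a cylinder of later times, so they can be split off one
    after the other. *)
Lemma future_cylinder_setI n C1 C2 E :
  measurable C1 -> measurable C2 -> future_cylinder n.+1 E ->
  future_cylinder n (B n @^-1` C1 `&` (Y n @^-1` C2 `&` E)) /\
  P (B n @^-1` C1 `&` (Y n @^-1` C2 `&` E)) =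
    (P (B n @^-1` C1) * P (Y n @^-1` C2) * P E)%E.
Proof.
move=> mC1 mC2 [J [A [Jn AJ ->]]].
have S2 : sigma_BY (inr n) (Y n @^-1` C2) by exists C2 => //; rewrite setTI.
have S1 : sigma_BY (inl n) (B n @^-1` C1) by exists C1 => //; rewrite setTI.
have nJ2 : inr n \notin J by apply/negP => /Jn; rewrite ltnn.
have [A2 [A2J E2 P2]] := independent_cylinderU1 nJ2 AJ S2.
have nJ1 : inl n \notin (inr n |` J)%fset.
  by rewrite !inE/=; apply/negP => /Jn; rewrite ltnn.
have [A1 [A1J E1 P1]] := independent_cylinderU1 nJ1 A2J S1.
rewrite E2 P1; split; last by rewrite -E2 P2 muleA.
rewrite E1; exists (inl n |` (inr n |` J))%fset, A1; split=> // i.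
by rewrite !inE => /orP[/eqP->//|/orP[/eqP->//|/Jn/ltnW]].
Qed.

Context (d3 : measure_display) (T3 : measurableType d3)
  (U : nat -> {RV P >-> T3}) (phi : T3 * (T1 * T2) -> T3) (u0 : T3).
Hypotheses (mphi : measurable_fun setT phi) (U0 : forall w, U 0%N w = u0)
  (US : forall n w, U n.+1 w = phi (U n w, (B n w, Y n w))).

Let V n w := (B n w, Y n w).

Let mV n : measurable_fun setT (V n).
Proof. by apply: measurable_fun_pair; exact: measurable_funPT. Qed.

(** Invariant of the induction along the chain [U], which starts at the constant [u0] and is driven
    by the innovations [V n]. The future of [n] includes the innovation [V n] itself. *)
Let state_independent n := forall C E,
  measurable C -> future_cylinder n E ->
  P (U n @^-1` C `&` E) = (P (U n @^-1` C) * P E)%E.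

Let measurable_state n C : measurable C -> measurable (U n @^-1` C).
Proof.
by move=> mC; rewrite -[X in measurable X]setTI; exact: measurable_funP.
Qed.

(** For a rectangle [D] the events of [V n] and [E] form one cylinder of time [n], independent of
    the state by assumption; general [D] follows by extension from rectangles. *)
Let state_pair_independent n A D E : state_independent n ->
  measurable A -> measurable D -> future_cylinder n.+1 E ->
  P (V n @^-1` D `&` (U n @^-1` A `&` E)) =
  (P (U n @^-1` A) * P E * P (V n @^-1` D))%E.
Proof.
move=> IH mA mD fE; have mE := future_cylinder_measurable fE.
apply: probability_setI_prod => //.
- by rewrite mule_ge0.
- by rewrite fin_numM// fin_num_measure//; exact: measurable_state.
- by apply: measurableI => //; exact: measurable_state.
move=> C1 C2 mC1 mC2.
have -> : V n @^-1` (C1 `*` C2) `&` (U n @^-1` A `&` E) =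
    U n @^-1` A `&` (B n @^-1` C1 `&` (Y n @^-1` C2 `&` E)).
  by apply/seteqP; split=> w /=; tauto.
have -> : V n @^-1` (C1 `*` C2) = B n @^-1` C1 `&` (Y n @^-1` C2 `&` setT).
  by apply/seteqP; split=> w /=; tauto.
have [f1 e1] := future_cylinder_setI mC1 mC2 fE.
have [_ e2] := future_cylinder_setI mC1 mC2 (future_cylinderT n.+1).
rewrite IH// e1 e2 probability_setT mule1 -!muleA; congr (_ * _)%E.
by rewrite [LHS]muleA muleC.
Qed.

(** The new state is a measurable function of [U n] and [V n], so independence from [E] need only be
    checked when this pair lies in a rectangle. At time 0 the state is constant and its events are
    trivial. *)
Lemma state_independent_future n : state_independent n.
Proof.
elim: n => [|n IH] C E mC fE.
  have -> : U 0%N @^-1` C = [set _ | C u0].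
    by apply/seteqP; split=> w /=; rewrite U0.
  have [Cu|nCu] := pselect (C u0).
    by rewrite (_ : [set _ | C u0] = setT) ?setTI ?probability_setT ?mul1e//;
      apply/seteqP; split.
  by rewrite (_ : [set _ | C u0] = set0) ?set0I ?measure0 ?mul0e//;
    apply/seteqP; split.
pose W w := (U n w, V n w).
have mW : measurable_fun setT W.
  by apply: measurable_fun_pair => //; exact: measurable_funPT.
have -> : U n.+1 @^-1` C = W @^-1` (phi @^-1` C).
  by apply/seteqP; split=> w /=; rewrite US.
have mE := future_cylinder_measurable fE.
rewrite [RHS]muleC; apply: probability_setI_prod => //.
- exact: fin_num_measure.
- move=> A D mA mD.
  have -> : W @^-1` (A `*` D) `&` E = V n @^-1` D `&` (U n @^-1` A `&` E).
    by apply/seteqP; split=> w /=; tauto.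
  have -> : W @^-1` (A `*` D) = V n @^-1` D `&` (U n @^-1` A `&` setT).
    by apply/seteqP; split=> w /=; tauto.
  rewrite !state_pair_independent//; last exact: future_cylinderT.
  by rewrite probability_setT mule1 muleA (muleC (P E)).
- by rewrite -[X in measurable X]setTI; exact: mphi.
Qed.

(** Independence makes the joint law of [U n] and [V n] a product, whose second factor is
    [alpha \x beta]; Tonelli then integrates over the innovation first. *)
Lemma state_pair_integral (alpha : probability T1 R) (beta : probability T2 R)
    n (h : T3 * (T1 * T2) -> \bar R) :
  has_law (B n) alpha -> has_law (Y n) beta ->
  measurable_fun setT h -> (forall z, (0 <= h z)%E) ->
  (\int[P]_w h (U n w, (B n w, Y n w)) =
   \int[P]_w \int[alpha \x beta]_z h (U n w, z))%E.
Proof.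
move=> Bn Yn mh h0.
pose W w := (U n w, V n w).
have mW : measurable_fun setT W.
  by apply: measurable_fun_pair => //; exact: measurable_funPT.
have VE D : measurable D -> (alpha \x beta)%E D = pushforward P (V n) D.
  move=> mD; pose m' : {measure set _ -> \bar R} := pushforward P (V n).
  rewrite -[RHS]/(m' (mV n) D); apply: product_measure_unique => // C1 C2 mC1 mC2.
  rewrite -[X in (X * _)%E]Bn// -[X in (_ * X)%E]Yn//.
  rewrite /m'/= /distribution /pushforward.
  have [_] := future_cylinder_setI mC1 mC2 (future_cylinderT n.+1).
  rewrite probability_setT mule1 => <-; congr (P _).
  by apply/seteqP; split=> w /=; tauto.
pose Vn : {RV P >-> (T1 * T2)%type} :=
  HB.pack (V n) (isMeasurableFun.Build _ _ _ _ (V n) (mV n)).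
have WE D : measurable D ->
    (distribution P (U n) \x distribution P Vn)%E D = pushforward P W D.
  move=> mD; pose m' : {measure set _ -> \bar R} := pushforward P W.
  rewrite -[RHS]/(m' mW D); apply: product_measure_unique => // A D' mA mD'.
  rewrite /m'/= /distribution /pushforward.
  have -> : W @^-1` (A `*` D') = V n @^-1` D' `&` (U n @^-1` A `&` setT).
    by apply/seteqP; split=> w /=; tauto.
  rewrite state_pair_independent// ?probability_setT ?mule1//.
    exact: state_independent_future.
  exact: future_cylinderT.
transitivity (\int[pushforward P W]_z h z)%E.
  by rewrite ge0_integral_pushforward.
rewrite (eq_measure_integral
  (distribution P (U n) \x distribution P Vn)%E); last first.
  by move=> A mA _; apply/esym; exact: WE.
rewrite fubini_tonelli1// ge0_integral_distribution//; last 2 first.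
- exact: measurable_fun_fubini_tonelli_F.
- by move=> u; apply: integral_ge0.
apply: eq_integral => w _ /=; rewrite /fubini_F.
apply: eq_measure_integral => A mA _; apply/esym; exact: VE.
Qed.

End independent_sequences.

(** * The stick-breaking operator on Lipschitz convex functions *)

Lemma integral_probability_cst d (T : measurableType d) (R : realType)
    (P : probability T R) (c : \bar R) : (\int[P]_x c = c)%E.
Proof.
by rewrite integral_cst// [X in (_ * X)%E]probability_setT mule1.
Qed.

(** Nonnegativity is included so that Tonelli and monotonicity of integrals apply without
    integrability conditions. The constant [L] is kept explicit because the operator below
    multiplies it by [rho]. *)
Definition lip_convex (R : realType) (d : nat) (L : R) (G : 'rV[R]_d -> R) :=
  [/\ 0 <= L, forall x, 0 <= G x, forall x y, G x <= G y + L * `|x - y| &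
   forall x y p, 0 <= p <= 1 ->
     G (p *: x + (1 - p) *: y) <= p * G x + (1 - p) * G y].

Definition stick_step (R : realType) (d : nat) (x : 'rV[R]_d)
    (z : 'rV[R]_d * R) : 'rV[R]_d := (1 - z.2) *: x + z.2 *: z.1.

Lemma lip_convex_continuous (R : realType) (d : nat) (L : R)
  (G : 'rV[R]_d -> R) : lip_convex L G -> continuous G.
Proof.
move=> [L0 _ GL _] x A /nbhs_ballP[e /= e0 eA].
(* The divisor [L + 1] stays positive when [L] is 0. *)
apply/nbhs_ballP; exists (e / (L + 1)) => /=.
  by rewrite divr_gt0// ltr_wpDl.
move=> y; rewrite mx_norm_ball /ball_/= => xy; apply: eA.
have : L * `|x - y| < e.
  apply: (@le_lt_trans _ _ ((L + 1) * `|x - y|)).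
    by rewrite ler_wpM2r// lerDl.
  by rewrite mulrC -ltr_pdivlMr// ltr_wpDl.
move=> H; rewrite /ball/= ltr_norml; apply/andP; split.
  have := GL y x; rewrite distrC in H *; lra.
have := GL x y; lra.
Qed.

Lemma measurable_lip_convex (R : realType) (d : nat) (L : R)
  (G : 'rV[R]_d -> R) : lip_convex L G -> measurable_fun setT G.
Proof. by move/lip_convex_continuous; exact: continuous_measurable_rV. Qed.

Lemma measurable_stick_step (R : realType) (d : nat) d' (T : measurableType d')
    (x : T -> 'rV[R]_d) (z : T -> 'rV[R]_d * R) :
  measurable_fun setT x -> measurable_fun setT z ->
  measurable_fun setT (fun w => stick_step (x w) (z w)).
Proof.
move=> mx mz; apply: measurable_fun_addrV; apply: measurable_fun_scalerV => //.
- by apply: measurable_funB => //; exact: measurableT_comp.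
- exact: measurableT_comp.
- exact: measurableT_comp.
Qed.

Section step_operator.
Context (R : realType) (d : nat) (gam : probability ('rV[R]_d * R)%type R)
  (rho : R).
Implicit Types (G : 'rV[R]_d -> R) (L : R) (x : 'rV[R]_d).
Hypotheses
  (gam_mean : (\int[gam]_z (`|z.2| * `|z.1|)%:E < +oo)%E)
  (gam_rho : (\int[gam]_z `|1 - z.2|%:E = rho%:E)%E).

(** This is [T_t] when [gam] is the law of the pair [(B, Y)]. Taking [fine] gives an operator on
    real functions, which can be iterated; on [lip_convex] functions the integral is finite. *)
Definition step_op (G : 'rV[R]_d -> R) (x : 'rV[R]_d) : R :=
  fine (\int[gam]_z (G (stick_step x z))%:E)%E.

Let measurable_step G L x : lip_convex L G ->
  measurable_fun setT (fun z => (G (stick_step x z))%:E).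
Proof.
move=> GL; apply/measurable_EFinP; apply: measurableT_comp.
  exact: measurable_lip_convex GL.
exact: measurable_stick_step.
Qed.

Let measurable_rho : measurable_fun setT (fun z : 'rV[R]_d * R => `|1 - z.2|%:E).
Proof.
apply/measurable_EFinP; apply: measurableT_comp => //.
exact: measurable_funB.
Qed.

Let measurable_mean :
  measurable_fun setT (fun z : 'rV[R]_d * R => (`|z.2| * `|z.1|)%:E).
Proof.
apply/measurable_EFinP; apply: measurable_funM; first exact: measurableT_comp.
by apply: measurableT_comp => //; exact: measurable_normrV.
Qed.

Lemma rho_ge0 : 0 <= rho.
Proof. by rewrite -lee_fin -gam_rho; apply: integral_ge0. Qed.

Let int_rho c : 0 <= c -> (\int[gam]_z (c * `|1 - z.2|)%:E = (c * rho)%:E)%E.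
Proof.
move=> c0; under eq_integral do rewrite EFinM.
by rewrite ge0_integralZl_EFin// gam_rho.
Qed.

(** With [z = (b, y)], comparison with [G 0] bounds the integrand by
    [G 0 + L * |x| * |1 - y| + L * |y| * |b|], which has a finite integral by [gam_rho] and
    [gam_mean]. *)
Lemma step_op_integral L G x : lip_convex L G ->
  (\int[gam]_z (G (stick_step x z))%:E = (step_op G x)%:E)%E.
Proof.
move=> GL; have [L0 G0 Glip _] := GL.
rewrite /step_op fineK// ge0_fin_numE; last first.
  by apply: integral_ge0 => z _; rewrite lee_fin.
apply: (@le_lt_trans _ _ (\int[gam]_z ((G 0)%:E + ((L * `|x|) * `|1 - z.2|)%:E
    + L%:E * (`|z.2| * `|z.1|)%:E))%E).
  apply: ge0_le_integral => //.
  - by move=> z _; rewrite lee_fin.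
  - exact: measurable_step GL.
  - apply: emeasurable_funD; last exact: measurable_funeM.
    apply: emeasurable_funD => //; under eq_fun do rewrite EFinM.
    exact: measurable_funeM.
  - move=> z _; rewrite -EFinM -!EFinD lee_fin.
    apply: le_trans (Glip _ 0) _; rewrite subr0 -addrA lerD2l.
    rewrite -mulrA -mulrDr ler_wpM2l//; apply: le_trans (ler_normD _ _) _.
    by rewrite !normrZ (mulrC `|x|).
rewrite ge0_integralD//; last 4 first.
- move=> z _; rewrite -EFinD lee_fin addr_ge0// !mulr_ge0//.
- apply: emeasurable_funD => //; under eq_fun do rewrite EFinM.
  exact: measurable_funeM.
- by move=> z _; rewrite -EFinM lee_fin !mulr_ge0.
- exact: measurable_funeM.
rewrite ge0_integralD//; last 3 first.
- by move=> z _; rewrite lee_fin.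
- by move=> z _; rewrite lee_fin !mulr_ge0.
- under eq_fun do rewrite EFinM.
  exact: measurable_funeM.
rewrite integral_probability_cst int_rho ?mulr_ge0// ge0_integralZl_EFin//.
by rewrite lte_add_pinfty ?ltry// lte_mul_pinfty// lee_fin.
Qed.

(** For a common [z] the images of two points differ by [1 - z.2] times the difference of the
    points, whence the factor [rho] after integration. Convexity is preserved because [stick_step]
    is affine in the point. *)
Lemma lip_convex_step_op L G : lip_convex L G -> lip_convex (L * rho) (step_op G).
Proof.
move=> GL; have [L0 G0 Glip Gconv] := GL; split.
- by rewrite mulr_ge0// rho_ge0.
- by move=> x; rewrite /step_op fine_ge0//; apply: integral_ge0 => z _; rewrite lee_fin.
- move=> x y; rewrite -lee_fin EFinD -!(step_op_integral _ GL).
  rewrite mulrAC -int_rho ?mulr_ge0// -ge0_integralD//; last 4 first.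
  + by move=> z _; rewrite lee_fin.
  + exact: measurable_step GL.
  + by move=> z _; rewrite lee_fin !mulr_ge0.
  + under eq_fun do rewrite EFinM.
    exact: measurable_funeM.
  apply: ge0_le_integral => //.
  + by move=> z _; rewrite lee_fin.
  + exact: measurable_step GL.
  + apply: emeasurable_funD; first exact: measurable_step GL.
    under eq_fun do rewrite EFinM.
    exact: measurable_funeM.
  + move=> z _; rewrite -EFinD lee_fin; apply: le_trans (Glip _ (stick_step y z)) _.
    rewrite lerD2l -mulrA ler_wpM2l// /stick_step opprD addrACA subrr addr0.
    by rewrite -scalerBr normrZ mulrC.
- move=> x y p /[dup] p01 /andP[p0 p1]; have q0 : 0 <= 1 - p by rewrite subr_ge0.
  rewrite -lee_fin EFinD !EFinM -!(step_op_integral _ GL).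
  rewrite -!ge0_integralZl_EFin//; try exact: measurable_step GL; last 2 first.
  + by move=> z _; rewrite lee_fin.
  + by move=> z _; rewrite lee_fin.
  rewrite -ge0_integralD//; last 4 first.
  + by move=> z _; rewrite -EFinM lee_fin mulr_ge0.
  + by apply: measurable_funeM; exact: measurable_step GL.
  + by move=> z _; rewrite -EFinM lee_fin mulr_ge0.
  + by apply: measurable_funeM; exact: measurable_step GL.
  apply: ge0_le_integral => //.
  + by move=> z _; rewrite lee_fin.
  + exact: measurable_step GL.
  + by apply: emeasurable_funD; apply: measurable_funeM; exact: measurable_step GL.
  + move=> z _; rewrite -!EFinM -EFinD lee_fin; apply: le_trans (Gconv _ _ _ p01).
    rewrite le_eqVlt; apply/orP; left; apply/eqP; congr (G _).
    rewrite /stick_step !scalerDr !scalerA [RHS]addrACA -scalerDl; congr (_ + _).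
      by rewrite (mulrC p) (mulrC (1 - p)).
    by congr (_ *: _); ring.
Qed.

Lemma lip_convex_iter_step_op L G n :
  lip_convex L G -> lip_convex (L * rho ^+ n) (iter n step_op G).
Proof.
move=> GL; elim: n => [|n IH]; first by rewrite expr0 mulr1.
by rewrite exprSr mulrA iterS; exact: lip_convex_step_op.
Qed.

End step_operator.

(** * Iterates of the operator and the Dirichlet mean *)

Lemma nneseries_geometric_lty (R : realType) (a r : R) : 0 <= a -> 0 <= r < 1 ->
  (\sum_(0 <= n <oo) (a * r ^+ n)%:E < +oo)%E.
Proof.
move=> a0 /andP[r0 r1].
apply: (@le_lt_trans _ _ (a / (1 - r))%:E); last exact: ltry.
apply: lime_le.
  by apply: is_cvg_nneseries => n _ _; rewrite lee_fin mulr_ge0// exprn_ge0.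
apply: nearW => n; rewrite sumEFin lee_fin.
have r1' : r != 1 by rewrite lt_eqF.
rewrite -[leLHS]/(series (geometric a r) n) geometric_seriesE//=.
apply: ler_wpM2r; first by rewrite invr_ge0 subr_ge0 ltW.
by rewrite ler_piMr// gerBl exprn_ge0.
Qed.

Section stick_breaking.
Context (dO : measure_display) (Omega : measurableType dO) (R : realType)
  (P : probability Omega R) (d : nat) (alpha : probability 'rV[R]_d R)
  (beta : probability R R) (B : nat -> {RV P >-> 'rV[R]_d})
  (Y : nat -> {RV P >-> R}).
Hypotheses
  (lawB : forall n, has_law (B n) alpha) (lawY : forall n, has_law (Y n) beta)
  (indBY : mutually_independent P (fun k : nat + nat => match k with
     | inl n => sigma_RV (B n) | inr n => sigma_RV (Y n) end)).

Let partial_mean n w : 'rV[R]_d := \sum_(i < n) stick_weight Y i w *: B i w.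

Let remaining_stick n w : R := \prod_(i < n) (1 - Y i w).

Let measurable_remaining_stick n : measurable_fun setT (remaining_stick n).
Proof.
by apply: measurable_prod => i _; exact: measurable_funB.
Qed.

Let measurable_stick_weight n : measurable_fun setT (stick_weight Y n).
Proof.
apply: measurable_funM; first exact: measurable_funPT.
exact: measurable_remaining_stick.
Qed.

Let measurable_partial_mean n : measurable_fun setT (partial_mean n).
Proof.
elim: n => [|n IH].
  rewrite (_ : partial_mean 0 = cst 0); first exact: measurable_cst.
  by apply/funext => w; rewrite /partial_mean big_ord0.
rewrite (_ : partial_mean n.+1 =
    fun w => partial_mean n w + stick_weight Y n w *: B n w).
  by apply: measurable_fun_addrV => //; exact: measurable_fun_scalerV.
by apply/funext => w; rewrite /partial_mean big_ord_recr.
Qed.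

(** [S_n] alone does not determine its successor from [B n] and [Y n]; together with the remaining
    stick [Pi_n] it does. *)
Let state n w := (partial_mean n w, remaining_stick n w).

Let measurable_state n : measurable_fun setT (state n).
Proof. exact: measurable_fun_pair. Qed.

Let stateRV n : {RV P >-> ('rV[R]_d * R)%type} :=
  HB.pack (state n)
    (isMeasurableFun.Build _ _ _ _ (state n) (measurable_state n)).

Let next (u : ('rV[R]_d * R) * ('rV[R]_d * R)) : 'rV[R]_d * R :=
  (u.1.1 + (u.1.2 * u.2.2) *: u.2.1, u.1.2 * (1 - u.2.2)).

Let measurable_next : measurable_fun setT next.
Proof.
apply: measurable_fun_pair.
  apply: measurable_fun_addrV; first exact: measurableT_comp.
  apply: measurable_fun_scalerV; last exact: measurableT_comp.
  by apply: measurable_funM; exact: measurableT_comp.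
apply: measurable_funM; first exact: measurableT_comp.
by apply: measurable_funB => //; exact: measurableT_comp.
Qed.

Let state0 w : state 0%N w = (0, 1).
Proof. by rewrite /state /partial_mean /remaining_stick !big_ord0. Qed.

Let stateS n w : state n.+1 w = next (state n w, (B n w, Y n w)).
Proof.
rewrite /state /next/= /partial_mean /remaining_stick !big_ord_recr/=.
by rewrite /stick_weight (mulrC (Y n w)).
Qed.

Let state_integral n (h : ('rV[R]_d * R) * ('rV[R]_d * R) -> \bar R) :
  measurable_fun setT h -> (forall z, (0 <= h z)%E) ->
  (\int[P]_w h (state n w, (B n w, Y n w)) =
   \int[P]_w \int[alpha \x beta]_z h (state n w, z))%E.
Proof.
move=> mh h0.
exact: (@state_pair_integral _ _ _ P _ _ _ _ B Y indBY _ _ stateRV next (0, 1)).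
Qed.

Let gam : probability ('rV[R]_d * R)%type R := (alpha \x beta)%E.

Context (rho : R).
Hypotheses
  (gam_mean : (\int[gam]_z (`|z.2| * `|z.1|)%:E < +oo)%E)
  (gam_rho : (\int[gam]_z `|1 - z.2|%:E = rho%:E)%E) (rho_lt1 : rho < 1).

(** The last break is moved onto the point: [S_(n+1) + Pi_(n+1) x = S_n + Pi_n x'] with
    [x' = stick_step x (B n, Y n)]. The induction hypothesis at [x'], integrated over the
    innovation, yields one more application of the operator on the outside; hence the induction is
    over all [x]. *)
Lemma integral_iter_step_op (G : 'rV[R]_d -> R) L n x : lip_convex L G ->
  (\int[P]_w (G (partial_mean n w + remaining_stick n w *: x))%:E =
   (iter n (step_op gam) G x)%:E)%E.
Proof.
move=> GL; have [_ G0 _ _] := GL.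
elim: n x => [|n IH] x.
  under eq_integral => w _ do
    rewrite /partial_mean /remaining_stick !big_ord0 add0r scale1r.
  by rewrite integral_probability_cst.
pose h (u : ('rV[R]_d * R) * ('rV[R]_d * R)) :=
  (G (u.1.1 + u.1.2 *: stick_step x u.2))%:E.
have mh : measurable_fun setT h.
  apply/measurable_EFinP; apply: measurableT_comp.
    exact: measurable_lip_convex GL.
  apply: measurable_fun_addrV; first exact: measurableT_comp.
  apply: measurable_fun_scalerV; first exact: measurableT_comp.
  exact: measurable_stick_step.
have h0 z : (0 <= h z)%E by rewrite lee_fin.
transitivity (\int[P]_w h (state n w, (B n w, Y n w)))%E.
  apply: eq_integral => w _; congr (G _)%:E.
  rewrite /partial_mean /remaining_stick !big_ord_recr/= -addrA; congr (_ + _).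
  by rewrite /stick_step/= scalerDr !scalerA addrC /stick_weight (mulrC (Y n w)).
rewrite state_integral//.
have mhs : measurable_fun setT
    (fun v : Omega * ('rV[R]_d * R) => h (state n v.1, v.2)).
  apply: measurableT_comp => //; apply: measurable_fun_pair => //.
  by apply: measurableT_comp => //; exact: measurable_state.
transitivity (\int[gam]_z \int[P]_w h (state n w, z))%E.
  exact: (fubini_tonelli (m1 := P) (m2 := gam) (fun v => h (state n v.1, v.2))).
have GLn := lip_convex_iter_step_op gam_mean gam_rho n GL.
rewrite -(step_op_integral gam_mean gam_rho _ GLn).
apply: eq_integral => z _; rewrite -IH; apply: eq_integral => w _; reflexivity.
Qed.

(** The factor [1 - Y n] is independent of the first [n] factors and contributes [rho]. *)
Lemma integral_remaining_stick n :
  (\int[P]_w `|remaining_stick n w|%:E = (rho ^+ n)%:E)%E.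
Proof.
elim: n => [|n IH].
  under eq_integral => w _ do rewrite /remaining_stick big_ord0 normr1.
  by rewrite integral_probability_cst.
pose h (u : ('rV[R]_d * R) * ('rV[R]_d * R)) := `|u.1.2 * (1 - u.2.2)|%:E.
have mh : measurable_fun setT h.
  apply/measurable_EFinP; apply: measurableT_comp => //.
  apply: measurable_funM; first exact: measurableT_comp.
  by apply: measurable_funB => //; exact: measurableT_comp.
transitivity (\int[P]_w h (state n w, (B n w, Y n w)))%E.
  by apply: eq_integral => w _; rewrite /h/= /remaining_stick big_ord_recr.
rewrite state_integral//; last by move=> z; rewrite lee_fin// !mulr_ge0.
under eq_integral => w _.
  under eq_integral do rewrite /h/= normrM EFinM.
  rewrite ge0_integralZl_EFin//; last first.
    apply/measurable_EFinP; apply: measurableT_comp => //.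
    exact: measurable_funB.
  rewrite [X in (_ * X)%E]gam_rho muleC; over.
rewrite ge0_integralZl_EFin ?IH ?exprS ?EFinM//.
- by apply/measurable_EFinP; exact: measurableT_comp.
- exact: rho_ge0 gam_rho.
Qed.

Let dominant w : \bar R :=
  (\sum_(0 <= n <oo) (`|stick_weight Y n w| * `|B n w|)%:E)%E.

Let measurable_term n :
  measurable_fun setT (fun w => (`|stick_weight Y n w| * `|B n w|)%:E).
Proof.
apply/measurable_EFinP; apply: measurable_funM; first exact: measurableT_comp.
by apply: measurableT_comp; [exact: measurable_normrV|exact: measurable_funPT].
Qed.

(** Since [W_n = Pi_n Y_n] with [Pi_n] independent of [(B_n, Y_n)], the [n]-th term has mean
    [m * rho ^+ n], and [rho < 1]. *)
Lemma integral_dominant_lty : (\int[P]_w dominant w < +oo)%E.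
Proof.
rewrite integral_nneseries//.
pose m := fine (\int[gam]_z (`|z.2| * `|z.1|)%:E)%E.
have mE : (\int[gam]_z (`|z.2| * `|z.1|)%:E)%E = m%:E.
  by rewrite /m fineK// ge0_fin_numE//; apply: integral_ge0.
have m0 : 0 <= m by rewrite fine_ge0//; apply: integral_ge0.
apply: le_lt_trans (@nneseries_geometric_lty _ m rho m0 _); last first.
  by rewrite (rho_ge0 gam_rho).
apply: lee_nneseries => [n _ _|n _]; first by apply: integral_ge0.
pose h (u : ('rV[R]_d * R) * ('rV[R]_d * R)) :=
  (`|u.1.2| * (`|u.2.2| * `|u.2.1|))%:E.
have mh2 : measurable_fun setT (fun z : 'rV[R]_d * R => (`|z.2| * `|z.1|)).
  apply: measurable_funM; first exact: measurableT_comp.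
  by apply: measurableT_comp => //; exact: measurable_normrV.
have mh : measurable_fun setT h.
  apply/measurable_EFinP; apply: measurable_funM.
    by apply: measurableT_comp => //; exact: measurableT_comp.
  by apply: (measurableT_comp mh2).
rewrite (_ : (\int[P]_w _)%E = \int[P]_w h (state n w, (B n w, Y n w)))%E; last first.
  apply: eq_integral => w _; rewrite /h/= /stick_weight normrM -/(remaining_stick n w).
  by rewrite mulrCA mulrA.
rewrite state_integral//; last by move=> z; rewrite lee_fin// !mulr_ge0.
under eq_integral => w _.
  under eq_integral do rewrite /h/= EFinM.
  rewrite ge0_integralZl_EFin//; last exact/measurable_EFinP.
  rewrite [X in (_ * X)%E]mE muleC; over.
rewrite ge0_integralZl_EFin ?integral_remaining_stick ?EFinM//.
by apply/measurable_EFinP; exact: measurableT_comp.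
Qed.

Context (X : {RV P >-> 'rV[R]_d}).
Hypothesis cvgX : {ae P, forall w,
  series (fun n => stick_weight Y n w *: B n w) @ \oo --> X w}.

(** Dominated convergence for [G (S_n)] under the bound [G 0 + L * dominant]. At [x = 0] the
    remaining stick drops out of [integral_iter_step_op], so the iterates at 0 are exactly the
    integrals of [G (S_n)]. *)
Lemma lip_convex_mean_cvg (G : 'rV[R]_d -> R) L : lip_convex L G ->
  P.-integrable setT (fun w => (G (X w))%:E) /\
  ((iter n (step_op gam) G 0)%:E @[n --> \oo] --> \int[P]_w (G (X w))%:E)%E.
Proof.
move=> GL; have [L0 G0 Glip _] := GL.
have mG := measurable_lip_convex GL.
have dom0 w : (0 <= dominant w)%E.
  by apply: nneseries_ge0 => n _ _; rewrite lee_fin.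
have mdom : measurable_fun setT dominant.
  by apply: ge0_emeasurable_sum.
have bound0 w : (0 <= (G 0)%:E + L%:E * dominant w)%E.
  by rewrite adde_ge0// ?mule_ge0// lee_fin.
have measurable_bound :
    measurable_fun setT (fun w => (G 0)%:E + L%:E * dominant w)%E.
  by apply: emeasurable_funD => //; exact: measurable_funeM.
have := @dominated_convergence _ _ _ P setT measurableT
  (fun n w => (G (partial_mean n w))%:E) (fun w => (G (X w))%:E)
  (fun w => (G 0)%:E + L%:E * dominant w)%E.
case.
- by move=> n; apply/measurable_EFinP; exact: measurableT_comp.
- by apply/measurable_EFinP; exact: measurableT_comp.
- apply: filterS cvgX => w Xw _; apply: cvg_EFin; first exact: nearW.
  have pmX : partial_mean ^~ w @ \oo --> X w.
    rewrite (_ : partial_mean ^~ w =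
      series (fun n => stick_weight Y n w *: B n w))//.
    by apply/funext => n; rewrite /partial_mean /series/= big_mkord.
  exact: (cvg_comp _ _ pmX (@lip_convex_continuous _ _ _ _ GL (X w))).
- apply/integrableP; split; first exact: measurable_bound.
  under eq_integral => w _ do rewrite gee0_abs//.
  rewrite ge0_integralD//; last 3 first.
  + by move=> w _; rewrite lee_fin.
  + by move=> w _; rewrite mule_ge0.
  + exact: measurable_funeM.
  rewrite integral_probability_cst.
  rewrite ge0_integralZl_EFin//.
  by rewrite lte_add_pinfty ?ltry// lte_mul_pinfty//; exact: integral_dominant_lty.
- apply: aeW => w n _; rewrite gee0_abs ?lee_fin//.
  apply: le_trans (_ : ((G 0)%:E + (L * `|partial_mean n w|)%:E <= _)%E).
    by rewrite -EFinD lee_fin; apply: le_trans (Glip _ 0) _; rewrite subr0.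
  rewrite leeD2l// EFinM; apply: lee_wpmul2l; first by rewrite lee_fin.
  apply: le_trans (nneseries_lim_ge n _); last by move=> k _ _; rewrite lee_fin.
  rewrite sumEFin lee_fin big_mkord; apply: le_trans (ler_norm_sum _ _ _) _.
  by apply: ler_sum => i _; rewrite normrZ.
move=> iG _ cG; split => //.
rewrite [X in X @ \oo --> _](_ : _ =
    [sequence \int[P]_w (G (partial_mean n w))%:E]_n)%E//.
apply/funext => n /=; rewrite -(integral_iter_step_op n 0 GL).
by apply: eq_integral => w _; rewrite scaler0 addr0.
Qed.

End stick_breaking.

(** * Comparison of beta(1, s) and beta(1, t) *)

Section density.
Import HBNNSimple.

(** The formula holds for indicators by hypothesis, extends to simple functions by linearity and to
    nonnegative functions by monotone convergence. *)
Lemma ge0_integral_density d (T : measurableType d) (R : realType)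
    (mu nu : {measure set T -> \bar R}) (p : T -> R) :
  measurable_fun setT p -> (forall x, 0 <= p x) ->
  (forall A, measurable A -> nu A = (\int[mu]_(x in A) (p x)%:E)%E) ->
  forall f : T -> \bar R, measurable_fun setT f -> (forall x, (0 <= f x)%E) ->
  (\int[nu]_x f x = \int[mu]_x (f x * (p x)%:E))%E.
Proof.
move=> mp p0 nuE f mf f0.
pose f_ := nnsfun_approx measurableT mf.
have mp' : measurable_fun setT (EFin \o p) by exact/measurable_EFinP.
have fcvg x : EFin \o f_^~ x @ \oo --> f x.
  by apply: cvg_nnsfun_approx => // *; exact: f0.
transitivity (limn (fun n => \int[nu]_x (f_ n x)%:E))%E.
  rewrite -monotone_convergence//.
  - by apply: eq_integral => x _; apply/esym/cvg_lim => //; exact: fcvg.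
  - by move=> n; exact/measurable_EFinP/measurable_funP.
  - by move=> n x _; rewrite lee_fin.
  - by move=> x _ m n mn; rewrite lee_fin; exact/lefP/nd_nnsfun_approx.
rewrite [RHS](_ : _ = limn (fun n => \int[mu]_x ((f_ n x)%:E * (p x)%:E)))%E.
  congr (limn _); apply/funext => n.
  transitivity (\sum_(k \in range (f_ n))
      (\int[nu]_x (k * \1_(f_ n @^-1` [set k]) x)%:E))%E.
    under eq_integral do rewrite fimfunE -fsumEFin//.
    rewrite ge0_integral_fsum//.
    - by move=> y; exact/measurable_EFinP/measurable_funM.
    - by move=> y x _; rewrite nnfun_muleindic_ge0.
  transitivity (\sum_(k \in range (f_ n))
      (\int[mu]_x ((k * \1_(f_ n @^-1` [set k]) x)%:E * (p x)%:E)))%E.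
    apply: eq_fsbigr => k /set_mem[x0 _ <-].
    set A := f_ n @^-1` _; set c := f_ n x0.
    have mA : measurable A by exact: measurable_funPTI.
    have c0 : 0 <= c by [].
    transitivity (c%:E * nu A)%E.
      under eq_integral do rewrite EFinM.
      rewrite ge0_integralZl_EFin//; last exact/measurable_EFinP.
      by rewrite integral_indic// setIT.
    rewrite nuE// integral_mkcond.
    under [RHS]eq_integral do rewrite EFinM -muleA.
    rewrite ge0_integralZl_EFin//.
    + congr (_ * _)%E; apply: eq_integral => x _.
      rewrite patchE indicE; case: ifPn => xA; first by rewrite mul1e.
      by rewrite mul0e.
    + by move=> x _; rewrite mule_ge0// lee_fin.
    + by apply: emeasurable_funM => //; exact/measurable_EFinP.
  rewrite -ge0_integral_fsum//.
  - apply: eq_integral => x _; rewrite [in RHS]fimfunE -fsumEFin//.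
    rewrite ge0_mule_fsuml// => k.
    by rewrite nnfun_muleindic_ge0.
  - move=> k; apply: emeasurable_funM => //.
    exact/measurable_EFinP/measurable_funM.
  - move=> k x _; apply: mule_ge0; rewrite ?lee_fin//.
    by rewrite -lee_fin nnfun_muleindic_ge0.
rewrite -monotone_convergence//.
- apply: eq_integral => x _; apply/esym/cvg_lim => //.
  by apply: cvgeZr => //; exact: fcvg.
- by move=> n; apply: emeasurable_funM => //; exact/measurable_EFinP/measurable_funP.
- by move=> n x _; rewrite mule_ge0// lee_fin.
- move=> x _ m n mn; apply: lee_wpmul2r; first by rewrite lee_fin.
  by rewrite lee_fin; exact/lefP/nd_nnsfun_approx.
Qed.

End density.

Section beta_comparison.
Context (R : realType).
Implicit Types (s t y : R) (g : R -> R).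

Lemma beta1_pdf_ge0 t y : 0 <= t -> 0 <= beta1_pdf t y.
Proof.
by move=> t0; rewrite /beta1_pdf; case: ifP => // _; rewrite mulr_ge0// powR_ge0.
Qed.

Lemma measurable_beta1_pdf t : measurable_fun setT (beta1_pdf t).
Proof.
apply: measurable_fun_ifT => //.
  by apply: measurable_and; apply: measurable_fun_ltr.
apply: measurable_funM => //; apply: (measurableT_comp (measurable_powR (t - 1))).
exact: measurable_funB.
Qed.

Lemma beta1_null t (beta : probability R R) : 0 < t ->
  (forall A, measurable A -> beta A = beta1 t A) ->
  {ae beta, forall y, 0 < y < 1}.
Proof.
move=> t0 betaE; exists (~` `]0, 1[%classic); split.
- exact: measurableC.
- rewrite betaE; last exact: measurableC.
  apply: integral0_eq => y /=; rewrite in_itv/= /beta1_pdf.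
  by case: ifP.
- by move=> y /=; rewrite in_itv/=.
Qed.

Lemma beta1_density t (beta : probability R R) (f : R -> \bar R) : 0 < t ->
  (forall A, measurable A -> beta A = beta1 t A) ->
  measurable_fun setT f -> (forall y, (0 <= f y)%E) ->
  (\int[beta]_y f y = \int[lebesgue_measure]_y (f y * (beta1_pdf t y)%:E))%E.
Proof.
move=> t0 betaE mf f0.
(* [lebesgue_measure] lives on [measurableTypeR R], whose display is not the one
   of the canonical measurable structure of [R]. *)
pose idR : R -> measurableTypeR R := idfun.
have midR : measurable_fun setT idR by move=> _ A mA; rewrite setTI.
pose nu : {measure set (measurableTypeR R) -> \bar R} := pushforward beta idR.
transitivity (\int[nu midR]_y f y)%E.
  by rewrite (ge0_integral_pushforward midR).
apply: (@ge0_integral_density _ _ R (@lebesgue_measure R)) => //.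
- exact: measurable_beta1_pdf.
- by move=> y; rewrite beta1_pdf_ge0// ltW.
Qed.

(** The exponents add up, [t - 1 = (t - s) + (s - 1)], over the nonzero base [1 - y]. For [s <= t]
    the ratio is nonincreasing in [y]; it is the weight [h] of the comparison. *)
Lemma beta1_pdf_ratio s t y : 0 < s -> 0 < y < 1 ->
  beta1_pdf t y = t / s * (1 - y) `^ (t - s) * beta1_pdf s y.
Proof.
move=> s0 y01; have /andP[y0 y1] := y01; rewrite /beta1_pdf y01.
have -> : t - 1 = (t - s) + (s - 1) by rewrite addrA subrK.
rewrite powRD; last by rewrite implybE; apply/orP; right; rewrite subr_eq0 gt_eqF.
by field; rewrite gt_eqF.
Qed.

(* A function lying below its chords issued from 0 stays below its value at 0
   on an initial interval and above it afterwards, so that a single level of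
   the nonincreasing weight [h] separates the two regimes. *)
Lemma chord_nonincreasing_level g h : (forall y p, 0 <= y <= 1 -> 0 <= p <= 1 ->
    g (p * y) <= (1 - p) * g 0 + p * g y) ->
  (forall y z, 0 <= y -> y <= z -> z <= 1 -> h z <= h y) ->
  (forall y, 0 <= y <= 1 -> 0 <= h y) ->
  exists2 k, 0 <= k & forall y, 0 < y < 1 -> (g y - g 0) * (h y - k) <= 0.
Proof.
move=> gchord hni h0.
pose A := [set y | 0 <= y <= 1 /\ g y <= g 0].
have A0 : A 0 by split => //; rewrite lexx ler01.
have A1 : ubound A 1 by move=> y [/andP[]].
have c0 : 0 <= sup A by apply: ub_le_sup => //; exists 1.
have c1 : sup A <= 1 by apply: ge_sup => //; exists 0.
(* The level is taken where [g] last fails to exceed [g 0]. At [sup A] itself the factor [h y - k]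
   vanishes, which settles that point whatever the sign of [g y - g 0]. *)
exists (h (sup A)); first by apply: h0; rewrite c0.
move=> y /andP[y0 y1]; have [yc|cy|->] := ltgtP y (sup A).
(* Some [z] in [A] lies beyond [y], and the chord from 0 to [z] keeps [g y] at most [g 0]. *)
- have [z [/andP[z0 z1] gz] yz] : exists2 z, A z & y < z.
    by apply: sup_gt => //; exists 0.
  have z0' : 0 < z by exact: lt_trans yz.
  have p01 : 0 <= y / z <= 1.
    by rewrite ler_pdivrMr// mul1r (ltW yz) andbT divr_ge0// ltW.
  have := gchord z (y / z); rewrite z0 z1 divfK ?gt_eqF// => /(_ isT p01) H.
  rewrite mulr_le0_ge0// ?subr_ge0 ?subr_le0.
    by move: p01 => /andP[p0 p1]; nra.
  by apply: hni => //; exact: ltW.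
- rewrite mulr_ge0_le0// ?subr_le0 ?subr_ge0.
    rewrite leNgt; apply/negP => gy.
    have : y <= sup A by apply: ub_le_sup; [exists 1|split; [rewrite !ltW|exact: ltW]].
    by rewrite leNgt cy.
  by apply: hni => //; exact: ltW.
- by rewrite subrr mulr0.
Qed.

(** Integrating [(g - g 0) * (h - k) <= 0] against [beta_s] bounds the integral of [g * h], that is
    of [g] against [beta_t], by [g 0 + k * (\int g d beta_s - g 0)], where the bracket is 0. *)
Lemma beta1_integral_le g s t (beta_s beta_t : probability R R) :
  0 < s -> s <= t ->
  (forall A, measurable A -> beta_s A = beta1 s A) ->
  (forall A, measurable A -> beta_t A = beta1 t A) ->
  measurable_fun setT g -> (forall y, 0 <= g y) ->
  (forall y p, 0 <= y <= 1 -> 0 <= p <= 1 ->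
    g (p * y) <= (1 - p) * g 0 + p * g y) ->
  (\int[beta_s]_y (g y)%:E = (g 0)%:E)%E ->
  (\int[beta_t]_y (g y)%:E <= (g 0)%:E)%E.
Proof.
move=> s0 st bs bt mg g0 gchord gs; have t0 : 0 < t := lt_le_trans s0 st.
pose h y := t / s * (1 - y) `^ (t - s).
have ts0 : 0 <= t / s by rewrite divr_ge0// ltW.
have [k k0 kP] : exists2 k, 0 <= k &
    forall y, 0 < y < 1 -> (g y - g 0) * (h y - k) <= 0.
  apply: chord_nonincreasing_level => // [y z y0 yz z1|y _]; last first.
    by rewrite mulr_ge0// powR_ge0.
  rewrite ler_wpM2l// ge0_ler_powR ?nnegrE ?subr_ge0 ?lerD2l ?lerN2//.
  exact: le_trans z1.
pose mu := @lebesgue_measure R.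
have mgE : measurable_fun [set: measurableTypeR R] (EFin \o g).
  exact/measurable_EFinP.
have mp (r : R) : measurable_fun [set: measurableTypeR R] (EFin \o beta1_pdf r).
  by apply/measurable_EFinP; exact: measurable_beta1_pdf.
have p0 r y : 0 < r -> (0 <= (beta1_pdf r y)%:E)%E.
  by move=> r0; rewrite lee_fin beta1_pdf_ge0// ltW.
have p1 r (b : probability R R) : 0 < r ->
    (forall A, measurable A -> b A = beta1 r A) ->
    (\int[mu]_y (beta1_pdf r y)%:E = 1)%E.
  by move=> r0 bE; rewrite -[LHS]/(beta1 r setT) -bE// probability_setT.
have gE0 y : (0 <= (g y)%:E)%E by rewrite lee_fin.
move: gs; rewrite (beta1_density s0 bs)// => gs.
rewrite (beta1_density t0 bt)//.
have mgp (r : R) : measurable_fun [set: measurableTypeR R]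
    (fun y => (g y)%:E * (beta1_pdf r y)%:E)%E.
  exact: (emeasurable_funM mgE (mp r)).
have mcp (c r : R) : measurable_fun [set: measurableTypeR R]
    (fun y => c%:E * (beta1_pdf r y)%:E)%E.
  exact: (measurable_funeM _ (mp r)).
have mcgp (c r : R) : measurable_fun [set: measurableTypeR R]
    (fun y => c%:E * ((g y)%:E * (beta1_pdf r y)%:E))%E.
  exact: (measurable_funeM _ (mgp r)).
(* The pointwise inequality is multiplied by the density for [s], and the subtracted terms are moved
   across so that both integrands are nonnegative. *)
have : (\int[mu]_y ((g y)%:E * (beta1_pdf t y)%:E +
                    (g 0 * k)%:E * (beta1_pdf s y)%:E) <=
        \int[mu]_y ((g 0)%:E * (beta1_pdf t y)%:E +
                    k%:E * ((g y)%:E * (beta1_pdf s y)%:E)))%E.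
  apply: ge0_le_integral => //.
  - by move=> y _; rewrite adde_ge0// mule_ge0// ?p0// lee_fin ?mulr_ge0.
  - by apply: emeasurable_funD.
  - by apply: emeasurable_funD.
  - move=> y _; rewrite -!EFinM -!EFinD lee_fin.
    have [y01|/negbTE y01] := boolP (0 < y < 1); last first.
      by rewrite /beta1_pdf y01 !mulr0.
    rewrite (beta1_pdf_ratio t s0 y01) -/(h y).
    have := kP _ y01; have := beta1_pdf_ge0 y (ltW s0); nra.
have mul_ge0 (a b : R) r : 0 < r -> 0 <= a -> (0 <= a%:E * (beta1_pdf r b)%:E)%E.
  by move=> r0 a0; rewrite mule_ge0 ?p0// lee_fin.
have mulg_ge0 y : (0 <= k%:E * ((g y)%:E * (beta1_pdf s y)%:E))%E.
  by apply: mule_ge0; [rewrite lee_fin|exact: mul_ge0].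
have gk0 : 0 <= g 0 * k by rewrite mulr_ge0.
rewrite !ge0_integralD//; try by move=> y _; exact: mul_ge0.
rewrite !ge0_integralZl_EFin//; try by move=> y _; exact: p0.
(* Both densities have mass 1, and [k * g 0] cancels. *)
- rewrite (p1 _ _ s0 bs) (p1 _ _ t0 bt) !mule1 gs -EFinM (mulrC (g 0) k).
  by rewrite leeD2rE.
- by move=> y _; exact: mul_ge0.
- exact: mp.
- exact: mp.
Qed.

End beta_comparison.

(** * One step of the operator for t applied to the law for s *)

Section beta1_moments.
Context (R : realType) (t : R) (beta : probability R R).
Hypotheses (t0 : 0 < t) (betaE : forall A, measurable A -> beta A = beta1 t A).

Let mnorm1B : measurable_fun [set: R] (fun y : R => `|1 - y|%:E).
Proof.
by apply/measurable_EFinP; apply: measurableT_comp => //; exact: measurable_funB.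
Qed.

Let mnorm : measurable_fun [set: R] (fun y : R => `|y|%:E).
Proof. by apply/measurable_EFinP; exact: normr_measurable. Qed.

(** On (0, 1), which carries [beta], the two integrands add up to 1. *)
Let norm_sum : (\int[beta]_y `|1 - y|%:E + \int[beta]_y `|y|%:E = 1)%E.
Proof.
rewrite -ge0_integralD// -[RHS](probability_setT beta) -[RHS]mul1e -integral_cst//.
apply: ge0_ae_eq_integral => //.
- exact: emeasurable_funD.
- by move=> y _; rewrite -EFinD lee_fin addr_ge0.
apply: filterS (beta1_null t0 betaE) => y /andP[y0 y1] _.
by rewrite -EFinD !ger0_norm ?subr_ge0 ?(ltW y0) ?(ltW y1)// subrK.
Qed.

Lemma beta1_norm_le1 : (\int[beta]_y `|y|%:E <= 1)%E.
Proof. by rewrite -norm_sum leeDr//; apply: integral_ge0. Qed.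

(** By [norm_sum] the value is 1 minus the mean of the absolute value. Were that mean 0, [y] would
    vanish almost everywhere, while it is positive almost everywhere. *)
Lemma beta1_contraction :
  exists2 rho : R, rho < 1 & (\int[beta]_y `|1 - y|%:E = rho%:E)%E.
Proof.
have yfin : (\int[beta]_y `|y|%:E)%E \is a fin_num.
  rewrite ge0_fin_numE; last by apply: integral_ge0.
  by apply: le_lt_trans beta1_norm_le1 _; rewrite ltry.
have rfin : (\int[beta]_y `|1 - y|%:E)%E \is a fin_num.
  rewrite ge0_fin_numE; last by apply: integral_ge0.
  apply: (@le_lt_trans _ _ 1%E); last by rewrite ltry.
  by rewrite -norm_sum leeDl//; apply: integral_ge0.
exists (fine (\int[beta]_y `|1 - y|%:E)%E); last by rewrite fineK.
rewrite -lte_fin fineK// -norm_sum lteDl// lt_neqAle integral_ge0// andbT eq_sym.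
apply/eqP => y0.
have mE : measurable_fun [set: R] (EFin : R -> \bar R) by exact/measurable_EFinP.
have [/(_ y0) H _] := ae_eq_integral_abs beta measurableT mE.
have : {ae beta, forall y : R, False}.
  apply: filterS2 H (beta1_null t0 betaE) => y /(_ Logic.I) [->].
  by rewrite ltxx.
(* A null set would contain the whole line, against total mass 1. *)
case=> A [mA A0 /(_ _) sA]; have : beta setT = 0%E.
  by rewrite (_ : setT = A) //; apply/seteqP; split => // y _; exact: sA.
by rewrite probability_setT => /eqP; rewrite onee_eq0.
Qed.

End beta1_moments.

Section step_comparison.
Context (R : realType) (d : nat) (alpha : probability 'rV[R]_d R).
Hypothesis alpha_mean : (\int[alpha]_b `|b|%:E < +oo)%E.
Implicit Types (t : R) (beta : probability R R).

Let mnormrV : measurable_fun setT (fun b : 'rV[R]_d => `|b|%:E).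
Proof. by apply/measurable_EFinP; exact: measurable_normrV. Qed.

Lemma beta1_step_mean t beta : 0 < t ->
  (forall A, measurable A -> beta A = beta1 t A) ->
  (\int[alpha \x beta]_z (`|z.2| * `|z.1|)%:E < +oo)%E.
Proof.
move=> t0 betaE; rewrite fubini_tonelli2//; last first.
  apply/measurable_EFinP; apply: measurable_funM; first exact: measurableT_comp.
  by apply: measurableT_comp => //; exact: measurable_normrV.
rewrite /fubini_G/=.
under eq_integral => y _.
  under eq_integral do rewrite EFinM.
  rewrite ge0_integralZl_EFin// muleC.
  over.
rewrite ge0_integralZl//=; last 2 first.
- by apply/measurable_EFinP; exact: normr_measurable.
- by apply: integral_ge0.
apply: (@le_lt_trans _ _ ((\int[alpha]_b `|b|%:E) * 1)%E).
  by apply: lee_wpmul2l; [apply: integral_ge0|exact: beta1_norm_le1 betaE].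
by rewrite mule1.
Qed.

Lemma beta1_step_contraction beta rho :
  (\int[beta]_y `|1 - y|%:E = rho%:E)%E ->
  (\int[alpha \x beta]_z `|1 - z.2|%:E = rho%:E)%E.
Proof.
move=> <-; rewrite fubini_tonelli2//; last first.
  apply/measurable_EFinP; apply: measurableT_comp => //.
  exact: measurable_funB.
by apply: eq_integral => y _; rewrite /fubini_G/= integral_probability_cst.
Qed.

Context (nu : probability 'rV[R]_d R) (G : 'rV[R]_d -> R) (L : R).
Hypotheses (nu_mean : (\int[nu]_x `|x|%:E < +oo)%E) (GL : lip_convex L G).

Let kappa : probability ('rV[R]_d * 'rV[R]_d)%type R := (nu \x alpha)%E.

Let mixed u y := G (stick_step u.1 (u.2, y)).

Let measurable_mixed :
  measurable_fun [set: ('rV[R]_d * 'rV[R]_d) * R] (fun v => (mixed v.1 v.2)%:E).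
Proof.
apply/measurable_EFinP; apply: measurableT_comp.
  exact: measurable_lip_convex GL.
apply: measurable_stick_step; first exact: measurableT_comp.
by apply: measurable_fun_pair => //; exact: measurableT_comp.
Qed.

(** The function [g] of the comparison, for a general law [nu] in place of [mu(s alpha)]; [u] holds
    the point and the atom. *)
Let mixed_mean y : R := fine (\int[kappa]_u (mixed u y)%:E)%E.

(** Finite, because the Lipschitz bound reduces the integral to the first moments of [nu] and
    [alpha]. *)
Let mixed_meanE y : ((mixed_mean y)%:E = \int[kappa]_u (mixed u y)%:E)%E.
Proof.
have [L0 G0 Glip _] := GL.
rewrite /mixed_mean fineK// ge0_fin_numE; last first.
  by apply: integral_ge0 => u _; rewrite lee_fin; exact: G0.
have mn1 : measurable_fun setT (fun u : 'rV[R]_d * 'rV[R]_d => `|u.1|%:E).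
  exact: (measurableT_comp mnormrV measurable_fst).
have mn2 : measurable_fun setT (fun u : 'rV[R]_d * 'rV[R]_d => `|u.2|%:E).
  exact: (measurableT_comp mnormrV measurable_snd).
have n1 : (\int[kappa]_u `|u.1|%:E < +oo)%E.
  rewrite fubini_tonelli1// /fubini_F/=.
  by under eq_integral do rewrite integral_probability_cst.
have n2 : (\int[kappa]_u `|u.2|%:E < +oo)%E.
  rewrite fubini_tonelli1// /fubini_F/=.
  by rewrite integral_probability_cst.
pose a1 := L * `|1 - y|; pose a2 := L * `|y|.
have a10 : 0 <= a1 by rewrite mulr_ge0.
have a20 : 0 <= a2 by rewrite mulr_ge0.
have ma1 : measurable_fun setT
    (fun u : 'rV[R]_d * 'rV[R]_d => a1%:E * `|u.1|%:E)%E.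
  exact: measurable_funeM.
have ma2 : measurable_fun setT
    (fun u : 'rV[R]_d * 'rV[R]_d => a2%:E * `|u.2|%:E)%E.
  exact: measurable_funeM.
have e10 (u : 'rV[R]_d * 'rV[R]_d) : (0 <= a1%:E * `|u.1|%:E)%E.
  by rewrite mule_ge0.
have e20 (u : 'rV[R]_d * 'rV[R]_d) : (0 <= a2%:E * `|u.2|%:E)%E.
  by rewrite mule_ge0.
have G00 : (0 <= (G 0)%:E)%E by rewrite lee_fin.
have e30 (u : 'rV[R]_d * 'rV[R]_d) : (0 <= (G 0)%:E + a1%:E * `|u.1|%:E)%E.
  by rewrite adde_ge0.
apply: (@le_lt_trans _ _
  (\int[kappa]_u ((G 0)%:E + a1%:E * `|u.1|%:E + a2%:E * `|u.2|%:E))%E).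
  apply: ge0_le_integral => //.
  - by move=> u _; rewrite lee_fin; exact: G0.
  - exact: (measurable_fun_pair1 y measurable_mixed).
  - by do 2 apply: emeasurable_funD => //.
  - move=> u _; rewrite -!EFinM -!EFinD lee_fin.
    apply: le_trans (Glip _ 0) _; rewrite subr0 -addrA lerD2l.
    rewrite -!mulrA -mulrDr ler_wpM2l//; apply: le_trans (ler_normD _ _) _.
    by rewrite !normrZ.
rewrite !ge0_integralD//; last by apply: emeasurable_funD.
rewrite !ge0_integralZl_EFin// integral_probability_cst.
by rewrite !lte_add_pinfty ?ltry// lte_mul_pinfty.
Qed.

Let mixed_mean_ge0 y : 0 <= mixed_mean y.
Proof.
have [_ G0 _ _] := GL.
by rewrite -lee_fin mixed_meanE; apply: integral_ge0 => u _; rewrite lee_fin; exact: G0.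
Qed.

Let mixed_mean0 : ((mixed_mean 0)%:E = \int[nu]_x (G x)%:E)%E.
Proof.
have [_ G0 _ _] := GL.
rewrite mixed_meanE; under eq_integral => u _.
  rewrite /mixed /stick_step/= subr0 scale1r scale0r addr0; over.
rewrite fubini_tonelli1//; last 2 first.
- have mG := measurable_lip_convex GL.
  by apply/measurable_EFinP; exact: (measurableT_comp mG measurable_fst).
- by move=> u; rewrite lee_fin.
apply: eq_integral => x _; rewrite /fubini_F/=.
by rewrite integral_probability_cst.
Qed.

(** For fixed [u] the argument of [G] is affine in [y], and [p * y] is the convex combination of [y]
    and 0; the convexity inequality of [G] is integrated over [u]. *)
Let mixed_mean_chord y p : 0 <= p <= 1 ->
  mixed_mean (p * y) <= (1 - p) * mixed_mean 0 + p * mixed_mean y.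
Proof.
have [_ G0 _ Gconv] := GL; move=> p01; have /andP[p0 p1] := p01.
have q0 : 0 <= 1 - p by rewrite subr_ge0.
have mm z : measurable_fun setT (fun u => (mixed u z)%:E).
  exact: (measurable_fun_pair1 z measurable_mixed).
have m0 u z : (0 <= (mixed u z)%:E)%E by rewrite lee_fin; exact: G0.
rewrite -lee_fin EFinD !EFinM !mixed_meanE.
rewrite -!ge0_integralZl_EFin// -ge0_integralD//; last 4 first.
- by move=> u _; rewrite mule_ge0.
- exact: measurable_funeM.
- by move=> u _; rewrite mule_ge0.
- exact: measurable_funeM.
apply: ge0_le_integral => //.
- by apply: emeasurable_funD; exact: measurable_funeM.
move=> u _; rewrite -!EFinM -EFinD lee_fin addrC.
apply: le_trans (_ : _ <= p * mixed u y + (1 - p) * mixed u 0) _; last by rewrite addrC.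
rewrite /mixed; apply: le_trans (Gconv _ _ _ p01).
rewrite le_eqVlt; apply/orP; left; apply/eqP; congr (G _).
rewrite /stick_step/= subr0 scale1r scale0r addr0 scalerDr !scalerA.
by rewrite addrAC -scalerDl; congr (_ *: _ + _); ring.
Qed.

Let measurable_mixed_mean : measurable_fun [set: R] mixed_mean.
Proof.
apply/measurable_EFinP.
rewrite (_ : EFin \o mixed_mean = fubini_G kappa (fun v => (mixed v.1 v.2)%:E)).
  apply: measurable_fun_fubini_tonelli_G; first exact: measurable_mixed.
  by have [_ G0 _ _] := GL; move=> v; rewrite lee_fin; exact: G0.
by apply/funext => y; rewrite /= mixed_meanE.
Qed.

(** Both sides are the integral of [G ((1 - y) x + y b)] over [x], [b] and [y]. The function [k]
    rearranges the variables so that [b] is integrated first and Tonelli can exchange [x] and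
    [y]. *)
Let integral_step_op_mixed t beta : 0 < t ->
  (forall A, measurable A -> beta A = beta1 t A) ->
  (\int[nu]_x (step_op (alpha \x beta)%E G x)%:E =
   \int[beta]_y (mixed_mean y)%:E)%E.
Proof.
move=> t0 betaE; have [_ G0 _ _] := GL.
have [rho _ /beta1_step_contraction rhoE] := beta1_contraction t0 betaE.
have m0 u y : (0 <= (mixed u y)%:E)%E by rewrite lee_fin; exact: G0.
pose k (v : ('rV[R]_d * R) * 'rV[R]_d) := (mixed (v.1.1, v.2) v.1.2)%:E.
have mk : measurable_fun setT k.
  apply/measurable_EFinP; apply: measurableT_comp.
    exact: measurable_lip_convex GL.
  apply: (measurable_stick_step (x := fun v => v.1.1) (z := fun v => (v.2, v.1.2))).
    exact: (measurableT_comp measurable_fst measurable_fst).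
  apply: measurable_fun_pair => //.
  exact: (measurableT_comp measurable_snd measurable_fst).
have mF := measurable_fun_fubini_tonelli_F (m2 := alpha) k mk (fun v => m0 _ _).
have inner x : ((step_op (alpha \x beta) G x)%:E =
    \int[beta]_y fubini_F alpha k (x, y))%E.
  rewrite -(step_op_integral (beta1_step_mean t0 betaE) rhoE x GL).
  rewrite fubini_tonelli2//; last 2 first.
  - apply/measurable_EFinP; apply: measurableT_comp.
      exact: measurable_lip_convex GL.
    exact: measurable_stick_step.
  - by move=> z; rewrite lee_fin.
under eq_integral do rewrite inner.
rewrite (fubini_tonelli (fubini_F alpha k))//; last first.
  by move=> v; apply: integral_ge0 => b _; exact: m0.
apply: eq_integral => y _; rewrite mixed_meanE fubini_tonelli1//.
exact: (measurable_fun_pair1 y measurable_mixed).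
Qed.

(** In terms of [mixed_mean], invariance for [s] says that its mean under [beta_s] is its value at
    0, which is what [beta1_integral_le] asks for. *)
Lemma integral_step_op_le s t (beta_s beta_t : probability R R) : 0 < s -> s <= t ->
  (forall A, measurable A -> beta_s A = beta1 s A) ->
  (forall A, measurable A -> beta_t A = beta1 t A) ->
  (\int[nu]_x (step_op (alpha \x beta_s)%E G x)%:E = \int[nu]_x (G x)%:E)%E ->
  (\int[nu]_x (step_op (alpha \x beta_t)%E G x)%:E <= \int[nu]_x (G x)%:E)%E.
Proof.
move=> s0 st bs bt.
rewrite (integral_step_op_mixed s0 bs) (integral_step_op_mixed (lt_le_trans s0 st) bt).
rewrite -mixed_mean0 => ms.
apply: (beta1_integral_le s0 st bs bt measurable_mixed_mean mixed_mean_ge0 _ ms).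
by move=> y p _; exact: mixed_mean_chord.
Qed.

End step_comparison.

(** * Convex functions on row vectors *)

Section convex_functions.
Context (R : realType) (d : nat).
Implicit Types (psi : 'rV[R]_d -> R) (x y u : 'rV[R]_d).

Lemma convexRd_le psi : convexRd psi -> forall x y p, 0 <= p <= 1 ->
  psi (p *: x + (1 - p) *: y) <= p * psi x + (1 - p) * psi y.
Proof.
move=> cpsi x y p /andP[p0 p1].
by have := cpsi (Itv01 p0 p1) x y; rewrite !inE; apply.
Qed.

End convex_functions.

Section convex_regularity.
Context (R : realType) (d : nat) (psi : 'rV[R]_d -> R).
Hypothesis cpsi : forall x y p, 0 <= p <= 1 ->
  psi (p *: x + (1 - p) *: y) <= p * psi x + (1 - p) * psi y.
Implicit Types (x y u : 'rV[R]_d).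

Let midpoint x y : psi (2^-1 *: x + 2^-1 *: y) <= 2^-1 * psi x + 2^-1 * psi y.
Proof.
have h : 0 <= (2^-1 : R) <= 1 by apply/andP; split; lra.
have := cpsi x y h; rewrite (_ : 1 - 2^-1 = 2^-1 :> R)//; lra.
Qed.

(** Induction on the number of coordinates kept: the truncation of [x] to [k + 1] coordinates is the
    midpoint of the truncation of [2 *: x] to [k] coordinates and a multiple of a basis vector. The
    radius doubles at each step, hence the quantification over [s]. *)
Lemma convex_bounded_above (r : R) : 0 < r ->
  exists M, forall x, `|x| <= r -> psi x <= M.
Proof.
pose trunc (k : nat) x : 'rV[R]_d := \row_i (if (i < k)%N then x 0 i else 0).
suff H k s : 0 < s -> exists M, forall x, `|x| <= s -> psi (trunc k x) <= M.
  move=> r0; have [M HM] := H d r r0; exists M => x /HM.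
  rewrite (_ : trunc d x = x)//; apply/rowP => i.
  by rewrite mxE ltn_ord.
elim: k s => [|k IH] s s0.
  exists (psi 0) => x _; rewrite (_ : trunc 0%N x = 0)//.
  by apply/rowP => i; rewrite !mxE.
(* Beyond the dimension, truncating changes nothing. *)
have [kd|dk] := ltnP k d; last first.
  have [M HM] := IH s s0; exists M => x /HM.
  rewrite (_ : trunc k.+1 x = trunc k x)//; apply/rowP => i; rewrite !mxE.
  by rewrite ltnS (leq_trans (ltnW (ltn_ord i)) dk) (leq_trans (ltn_ord i) dk).
have [M HM] := IH (2 * s) ltac:(lra).
pose e : 'rV[R]_d := delta_mx 0 (Ordinal kd).
exists (2^-1 * M + 2^-1 * (`|psi ((2 * s) *: e)| + `|psi (- (2 * s) *: e)|)) => x xs.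
have -> : trunc k.+1 x = 2^-1 *: trunc k (2 *: x) +
    2^-1 *: ((2 * x 0 (Ordinal kd)) *: e).
  apply/rowP => i; rewrite !mxE eqxx/= ltnS leq_eqVlt.
  have [ik|ik] /= := eqVneq (i : nat) k.
    have -> : i = Ordinal kd by exact: val_inj.
    by rewrite eqxx ltnn/=; field.
  have -> : (i == Ordinal kd) = false by apply/eqP => /(congr1 val)/= /eqP; exact/negP.
  by rewrite /= mulr0n !mulr0 addr0; case: ifP => _; [field|rewrite mulr0].
apply: le_trans (midpoint _ _) _; apply: lerD.
  rewrite ler_wpM2l// ?invr_ge0//; apply: HM.
  by rewrite normrZ ger0_norm// ler_wpM2l.
rewrite ler_wpM2l ?invr_ge0//.
have := le_trans (coord_le_norm x (Ordinal kd)) xs.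
set a := x 0 _; rewrite ler_norml => /andP[a1 a2].
(* The weight that writes [2 * a] as a convex combination of [2 * s] and [- (2 * s)], so that two
   values of [psi] bound it on the whole segment. *)
pose p := (a + s) / (2 * s).
have p01 : 0 <= p <= 1.
  rewrite /p ler_pdivrMr ?mulr_gt0// divr_ge0//=; lra.
have := cpsi ((2 * s) *: e) (- (2 * s) *: e) p01.
rewrite !scalerA -scalerDl.
have -> : p * (2 * s) + (1 - p) * - (2 * s) = 2 * a.
  by rewrite /p; field; rewrite gt_eqF.
move=> H; apply: le_trans H _; move: p01 => /andP[p0 p1].
have := ler_norm (psi ((2 * s) *: e)); have := ler_norm (psi (- (2 * s) *: e)).
have := normr_ge0 (psi ((2 * s) *: e)); have := normr_ge0 (psi (- (2 * s) *: e)).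
nra.
Qed.

(** From above, [x + u] lies between [x] and the point at distance 1 in the direction of [u], where
    [psi] is at most [M]. From below, [x] is the midpoint of [x + u] and [x - u], and the upper
    bound applies to [- u]. *)
Lemma convex_locally_lipschitz x :
  exists2 K, 0 <= K & forall u, `|u| <= 1 -> `|psi (x + u) - psi x| <= K * `|u|.
Proof.
have [M HM] := @convex_bounded_above (`|x| + 1) ltac:(by rewrite ltr_wpDl).
have Mx : psi x <= M by apply: HM; rewrite lerDl.
have K0 : 0 <= M - psi x by rewrite subr_ge0.
have up u : `|u| <= 1 -> psi (x + u) - psi x <= (M - psi x) * `|u|.
  move=> u1; have [->|u0] := eqVneq u 0; first by rewrite addr0 subrr normr0 mulr0.
  have nu0 : 0 < `|u| by rewrite normr_gt0.
  have p01 : 0 <= `|u| <= 1 by rewrite normr_ge0.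
  have := cpsi (x + `|u|^-1 *: u) x p01.
  rewrite scalerDr scalerA divff ?gt_eqF// scale1r.
  rewrite addrAC -scalerDl addrCA subrr addr0 scale1r.
  have : psi (x + `|u|^-1 *: u) <= M.
    apply: HM; apply: le_trans (ler_normD _ _) _; rewrite lerD2l.
    by rewrite normrZ ger0_norm ?invr_ge0// mulVf// gt_eqF.
  nra.
exists (M - psi x) => // u u1; rewrite ler_norml up// andbT.
have := up (- u); rewrite normrN => /(_ u1) H.
have := midpoint (x + u) (x - u).
rewrite -scalerDr addrACA subrr addr0 scalerDr -scalerDl.
rewrite (_ : 2^-1 + 2^-1 = 1 :> R) ?scale1r; lra.
Qed.

Lemma convex_continuous : continuous psi.
Proof.
move=> x A /nbhs_ballP[e /= e0 eA].
have [K K0 HK] := convex_locally_lipschitz x.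
apply/nbhs_ballP; exists (Num.min 1 (e / (K + 1))) => /=.
  by rewrite lt_min ltr01/= divr_gt0// ltr_wpDl.
move=> y; rewrite mx_norm_ball /ball_/= lt_min => /andP[xy1 xye]; apply: eA.
have yx1 : `|y - x| <= 1 by rewrite distrC ltW.
have := HK _ yx1; rewrite (addrC x) subrK (distrC y) (distrC (psi y)) => H.
rewrite /ball/=.
apply: le_lt_trans H _; apply: (@le_lt_trans _ _ ((K + 1) * `|x - y|)).
  by rewrite ler_wpM2r// lerDl.
by rewrite mulrC -ltr_pdivlMr// ltr_wpDl.
Qed.

(** Outside the unit ball, [x / |x|] lies between 0 and [x], so convexity propagates the lower bound
    from the unit sphere outwards. This makes negative parts integrable under laws with a mean. *)
Lemma convex_linear_minorant :
  exists2 C, 0 <= C & forall x, - (C * (1 + `|x|)) <= psi x.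
Proof.
have [K K0 HK] := convex_locally_lipschitz 0.
exists (K + `|psi 0|) => [|x]; first by rewrite addr_ge0.
have lo u : `|u| <= 1 -> psi 0 - K * `|u| <= psi u.
  by move=> /HK; rewrite add0r ler_norml => /andP[H _]; lra.
have n0 := normr_ge0 (psi 0); have n1 := ler_norm (- psi 0); rewrite normrN in n1.
have x0 := normr_ge0 x.
have [x1|x1] := leP `|x| 1; first by have := lo _ x1; nra.
have p01 : 0 <= `|x|^-1 <= 1.
  by rewrite invr_ge0 normr_ge0 invf_le1 ?ltW// (lt_trans ltr01).
have := cpsi x 0 p01; rewrite scaler0 addr0.
have xn : `| `|x|^-1 *: x| = 1.
  by rewrite normrZ ger0_norm ?invr_ge0// mulVf// gt_eqF// (lt_trans ltr01).
have := lo (`|x|^-1 *: x); rewrite xn => /(_ (lexx 1)) H1 H2.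
have {H1 H2} := le_trans H1 H2.
have xx : `|x|^-1 * `|x| = 1 by rewrite mulVf// gt_eqF// (lt_trans ltr01).
move=> H; have := ler_wpM2l x0 H.
have -> : `|x| * (`|x|^-1 * psi x + (1 - `|x|^-1) * psi 0) =
    (`|x|^-1 * `|x|) * psi x + (`|x| - `|x|^-1 * `|x|) * psi 0 by ring.
rewrite xx; nra.
Qed.

End convex_regularity.

(** * Lipschitz approximation from below by the Pasch-Hausdorff envelope *)

Definition inf_convolution (R : realType) (d : nat) (psi : 'rV[R]_d -> R)
    (L : R) (x : 'rV[R]_d) : R := inf (range (fun y => psi y + L * `|x - y|)).

Section inf_convolution.
Context (R : realType) (d : nat) (psi : 'rV[R]_d -> R).
Hypotheses (psi0 : forall x, 0 <= psi x)
  (cpsi : forall x y p, 0 <= p <= 1 ->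
     psi (p *: x + (1 - p) *: y) <= p * psi x + (1 - p) * psi y).
Implicit Types (x y : 'rV[R]_d) (L : R).

(** Nonnegativity of [psi] bounds the set below; on an unbounded set [inf] would be a default
    value. *)
Let has_inf_range L x : 0 <= L ->
  has_inf (range (fun y => psi y + L * `|x - y|)).
Proof.
move=> L0; split; first by exists (psi x + L * `|x - x|); exists x.
by exists 0 => _ [y _ <-]; rewrite addr_ge0 ?mulr_ge0.
Qed.

Lemma inf_convolution_le L x y : 0 <= L ->
  inf_convolution psi L x <= psi y + L * `|x - y|.
Proof.
by move=> L0; apply: ge_inf; [have [] := has_inf_range x L0|exists y].
Qed.

Lemma le_inf_convolution L x c : (forall y, c <= psi y + L * `|x - y|) ->
  c <= inf_convolution psi L x.
Proof.
move=> H; apply: lb_le_inf; first by exists (psi x + L * `|x - x|); exists x.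
by move=> _ [y _ <-].
Qed.

Lemma inf_convolution_ge0 L x : 0 <= L -> 0 <= inf_convolution psi L x.
Proof.
by move=> L0; apply: le_inf_convolution => y; rewrite addr_ge0 ?mulr_ge0.
Qed.

Lemma inf_convolution_le_id L x : 0 <= L -> inf_convolution psi L x <= psi x.
Proof.
by move=> L0; have := inf_convolution_le x x L0; rewrite subrr normr0 mulr0 addr0.
Qed.

Lemma inf_convolution_homo L L' x : 0 <= L -> L <= L' ->
  inf_convolution psi L x <= inf_convolution psi L' x.
Proof.
move=> L0 LL; apply: le_inf_convolution => y.
by apply: le_trans (inf_convolution_le x y L0) _; rewrite lerD2l ler_wpM2r.
Qed.

(** The Lipschitz bound is the triangle inequality under the infimum. For convexity, the combination
    of near-minimisers [x'] and [y'], each within [e] of its infimum, is a competitor at the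
    combined point. *)
Lemma lip_convex_inf_convolution L : 0 <= L ->
  lip_convex L (inf_convolution psi L).
Proof.
move=> L0; split => //.
- by move=> x; exact: inf_convolution_ge0.
- move=> x y; rewrite -lerBlDr; apply: le_inf_convolution => z.
  rewrite lerBlDr; apply: le_trans (inf_convolution_le x z L0) _.
  rewrite -addrA lerD2l -mulrDr ler_wpM2l// [leRHS]addrC.
  exact: ler_distD.
- move=> x y p /[dup] p01 /andP[p0 p1]; apply/ler_addgt0Pr => e e0.
  have q0 : 0 <= 1 - p by rewrite subr_ge0.
  have [_ [x' _ <-] Hx] := inf_adherent e0 (has_inf_range x L0).
  have [_ [y' _ <-] Hy] := inf_adherent e0 (has_inf_range y L0).
  rewrite -/(inf_convolution psi L x) in Hx.
  rewrite -/(inf_convolution psi L y) in Hy.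
  apply: le_trans (inf_convolution_le _ (p *: x' + (1 - p) *: y') L0) _.
  have := cpsi x' y' p01.
  have : `|p *: x + (1 - p) *: y - (p *: x' + (1 - p) *: y')| <=
      p * `|x - x'| + (1 - p) * `|y - y'|.
    rewrite opprD addrACA -!scalerBr; apply: le_trans (ler_normD _ _) _.
    by rewrite !normrZ !ger0_norm.
  move=> /(ler_wpM2l L0); nra.
Qed.

(** Competitors within distance [r] of [x] have nearly the value [psi x] by continuity; farther ones
    pay a penalty of at least [n * r], which exceeds [psi x] for large [n] while [psi] stays
    nonnegative. *)
Lemma inf_convolution_cvg x :
  inf_convolution psi n%:R x @[n --> \oo] --> psi x.
Proof.
apply/cvgrPdist_le => e e0.
have /(_ (ball (psi x) e)) := @convex_continuous _ _ _ cpsi x.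
move=> /(_ (nbhsx_ballx _ _ e0)) /nbhs_ballP[r /= r0 Hr].
near=> n.
have n0 : 0 <= n%:R :> R by [].
have nr : psi x <= n%:R * r.
  rewrite -ler_pdivrMr//; near: n; exact: nbhs_infty_ger.
rewrite ger0_norm ?subr_ge0 ?inf_convolution_le_id// lerBlDl -lerBlDr.
apply: le_inf_convolution => y.
have [xy|xy] := ltP `|x - y| r.
  have : ball (psi x) e (psi y) by apply: Hr; rewrite mx_norm_ball.
  rewrite /ball/= ltr_distl => /andP[_ H].
  have : 0 <= n%:R * `|x - y| by rewrite mulr_ge0.
  lra.
have := ler_wpM2l n0 xy; have := psi0 y; lra.
Unshelve. all: by end_near. Qed.

End inf_convolution.

(** * From Lipschitz test functions to all convex functions *)

Section strassen_from_lipschitz.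
Context (R : realType) (d : nat) (mu nu : probability 'rV[R]_d R).
Hypothesis le_lip : forall (G : 'rV[R]_d -> R) L, lip_convex L G ->
  (\int[mu]_x (G x)%:E <= \int[nu]_x (G x)%:E)%E.

(** Monotone convergence of the envelopes is needed for [mu] only: for [nu] each envelope is at most
    [psi]. *)
Lemma nonneg_convex_integral_le (psi : 'rV[R]_d -> R) :
  (forall x, 0 <= psi x) ->
  (forall x y p, 0 <= p <= 1 ->
     psi (p *: x + (1 - p) *: y) <= p * psi x + (1 - p) * psi y) ->
  (\int[mu]_x (psi x)%:E <= \int[nu]_x (psi x)%:E)%E.
Proof.
move=> psi0 cpsi.
pose psi_ n x : \bar R := (inf_convolution psi n%:R x)%:E.
have GL n := lip_convex_inf_convolution psi0 cpsi (ler0n R n).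
have mpsi_ n : measurable_fun setT (psi_ n).
  by apply/measurable_EFinP; exact: measurable_lip_convex (GL n).
have psi_0 n x : (0 <= psi_ n x)%E by rewrite lee_fin inf_convolution_ge0.
have mpsi : measurable_fun setT (fun x => (psi x)%:E).
  apply/measurable_EFinP.
  exact: continuous_measurable_rV (convex_continuous cpsi).
have lim_psi_ x : limn (psi_ ^~ x) = (psi x)%:E.
  apply/cvg_lim => //; apply: cvg_EFin; first exact: nearW.
  exact: inf_convolution_cvg.
have ndpsi_ x m n : (m <= n)%N -> (psi_ m x <= psi_ n x)%E.
  by move=> mn; rewrite lee_fin inf_convolution_homo// ler_nat.
have cpsi_ := @cvg_monotone_convergence _ _ _ mu setT measurableT psi_ mpsi_
  (fun n x _ => psi_0 n x) (fun x _ => ndpsi_ x).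
rewrite -(eq_integral _ _ (fun x _ => lim_psi_ x)) -(cvg_lim _ cpsi_)//.
apply: lime_le; first exact: cvgP cpsi_.
apply: nearW => n; apply: le_trans (le_lip (GL n)) _.
apply: ge0_le_integral => //.
- by move=> x _; exact: psi_0.
- exact: mpsi_.
- by move=> x _; rewrite lee_fin inf_convolution_le_id.
Qed.

Hypotheses (mu_mean : (\int[mu]_x `|x|%:E < +oo)%E)
  (nu_mean : (\int[nu]_x `|x|%:E < +oo)%E).

(* [max (psi, - n) + n] is nonnegative and convex, and it equals the positive part
   of [psi], plus [n], minus the negative part truncated at [n]. *)
Lemma convex_integral_le (psi : 'rV[R]_d -> R) :
  (forall x y p, 0 <= p <= 1 ->
     psi (p *: x + (1 - p) *: y) <= p * psi x + (1 - p) * psi y) ->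
  (\int[mu]_x (psi x)%:E <= \int[nu]_x (psi x)%:E)%E.
Proof.
move=> cpsi.
have mpsi : measurable_fun setT psi.
  exact: continuous_measurable_rV (convex_continuous cpsi).
pose pos x := Num.max (psi x) 0.
pose neg x := Num.max (- psi x) 0.
pose trunc n x := Num.max (psi x) (- n%:R) + n%:R.
pose negn n x := Num.min (neg x) n%:R.
have pos0 x : 0 <= pos x by rewrite le_max lexx orbT.
have neg0 x : 0 <= neg x by rewrite le_max lexx orbT.
have trunc0 n x : 0 <= trunc n x.
  by rewrite -lerBlDr sub0r le_max lexx orbT.
have negn0 n x : 0 <= negn n x by rewrite le_min neg0 ler0n.
have split_trunc n x : pos x + n%:R = trunc n x + negn n x.
  have n0 : 0 <= n%:R :> R by [].
  rewrite /pos /trunc /negn /neg; have [p0|p0] := leP 0 (psi x).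
    rewrite max_l; last by lra.
    rewrite [Num.max (- _) _]max_r; last by lra.
    by rewrite min_l// addr0.
  rewrite (@max_l _ _ (- psi x)); last by lra.
  have [pn|pn] := leP (- n%:R) (psi x); last by rewrite min_r; lra.
  by rewrite min_l; lra.
have mpos : measurable_fun setT (EFin \o pos).
  by apply/measurable_EFinP; exact: measurable_maxr.
have mneg : measurable_fun setT (EFin \o neg).
  by apply/measurable_EFinP; apply: measurable_maxr => //; exact: measurableT_comp.
have mtrunc n : measurable_fun setT (EFin \o trunc n).
  by apply/measurable_EFinP; apply: measurable_funD => //; exact: measurable_maxr.
have mnegn n : measurable_fun setT (EFin \o negn n).
  apply/measurable_EFinP; apply: measurable_minr => //.
  by apply/measurable_EFinP.
have splitE (xi : probability 'rV[R]_d R) n :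
    (\int[xi]_x (pos x)%:E + n%:R%:E =
     \int[xi]_x (trunc n x)%:E + \int[xi]_x (negn n x)%:E)%E.
  rewrite -[n%:R%:E]mule1 -{1}(probability_setT xi) -integral_cst//.
  rewrite -!ge0_integralD//.
  - by apply: eq_integral => x _; rewrite -!EFinD split_trunc.
  - by move=> x _; exact: trunc0.
  - exact: mtrunc.
  - by move=> x _; exact: negn0.
  - exact: mnegn.
  - by move=> x _; exact: pos0.
  - by move=> x _; rewrite lee_fin.
have intE (xi : probability 'rV[R]_d R) : (\int[xi]_x (psi x)%:E =
    \int[xi]_x (pos x)%:E - \int[xi]_x (neg x)%:E)%E.
  by rewrite integralE; congr (_ - _)%E; apply: eq_integral => x _;
    rewrite ?funeposE ?funenegE /pos /neg EFin_max.
have negfin (xi : probability 'rV[R]_d R) :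
    (\int[xi]_x `|x|%:E < +oo)%E -> (\int[xi]_x (neg x)%:E < +oo)%E.
  move=> xi_mean; have [C C0 HC] := convex_linear_minorant cpsi.
  have mn : measurable_fun setT (fun x : 'rV[R]_d => `|x|%:E).
    by apply/measurable_EFinP; exact: measurable_normrV.
  apply: (@le_lt_trans _ _ (\int[xi]_x (C%:E + C%:E * `|x|%:E))%E).
    apply: ge0_le_integral => //.
    - by move=> x _; rewrite lee_fin; exact: neg0.
    - by apply: emeasurable_funD => //; exact: measurable_funeM.
    - move=> x _; rewrite -EFinM -EFinD lee_fin ge_max; apply/andP; split.
        by have := HC x; lra.
      by rewrite addr_ge0 ?mulr_ge0.
  rewrite ge0_integralD//; last 2 first.
  - by move=> x _; rewrite -EFinM lee_fin mulr_ge0.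
  - exact: measurable_funeM.
  rewrite ge0_integralZl_EFin// integral_probability_cst.
  by rewrite lte_add_pinfty ?ltry// lte_mul_pinfty.
have int_ge0 (xi : probability 'rV[R]_d R) (f : 'rV[R]_d -> R) :
    (forall x, 0 <= f x) -> (0 <= \int[xi]_x (f x)%:E)%E.
  by move=> f0; apply: integral_ge0 => x _; rewrite lee_fin.
have negE (xi : probability 'rV[R]_d R) : (\int[xi]_x `|x|%:E < +oo)%E ->
    exists2 a : R, 0 <= a & (\int[xi]_x (neg x)%:E = a%:E)%E.
  move=> /negfin xi_neg; exists (fine (\int[xi]_x (neg x)%:E)%E).
    by rewrite fine_ge0// int_ge0.
  by rewrite fineK// ge0_fin_numE// int_ge0.
have [a a0 aE] := negE _ mu_mean; have [b b0 bE] := negE _ nu_mean.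
rewrite !intE aE bE.
(* The negative part has the finite integral [b], so an infinite positive part makes the right-hand
   side [+oo]. *)
have [->|nu_pos_fin] := eqVneq (\int[nu]_x (pos x)%:E)%E +oo%E.
  by rewrite addye// leey.
pose v := fine (\int[nu]_x (pos x)%:E)%E.
have vE : (\int[nu]_x (pos x)%:E = v%:E)%E.
  by rewrite /v fineK// ge0_fin_numE ?int_ge0// lt_neqAle nu_pos_fin leey.
(* The truncations are compared and rewritten by [splitE] for both laws; [n] cancels, and the
   truncated negative part under [mu] is bounded by [a]. *)
have key n : (\int[mu]_x (pos x)%:E + \int[nu]_x (negn n x)%:E <= (v + a)%:E)%E.
  have le_trunc : (\int[mu]_x (trunc n x)%:E <= \int[nu]_x (trunc n x)%:E)%E.
    apply: nonneg_convex_integral_le => // x y p /[dup] p01 /andP[p0 p1].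
    have q0 : 0 <= 1 - p by rewrite subr_ge0.
    rewrite /trunc -lerBrDr ge_max; apply/andP; split.
      apply: le_trans (cpsi _ _ _ p01) _.
      have : psi x <= Num.max (psi x) (- n%:R) by rewrite le_max lexx.
      have : psi y <= Num.max (psi y) (- n%:R) by rewrite le_max lexx.
      by move=> /(ler_wpM2l q0) + /(ler_wpM2l p0); lra.
    have : - n%:R <= Num.max (psi x) (- n%:R) by rewrite le_max lexx orbT.
    have : - n%:R <= Num.max (psi y) (- n%:R) by rewrite le_max lexx orbT.
    by move=> /(ler_wpM2l q0) + /(ler_wpM2l p0); lra.
  have negn_le : (\int[mu]_x (negn n x)%:E <= a%:E)%E.
    rewrite -aE; apply: ge0_le_integral => //.
    + by move=> x _; exact: negn0.
    + exact: mnegn.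
    + by move=> x _; rewrite lee_fin ge_min lexx.
  have e1 := splitE mu n; have e2 := splitE nu n; rewrite vE -EFinD in e2.
  have [nt ntE] : exists r : R, (\int[nu]_x (trunc n x)%:E = r%:E)%E.
    exists (fine (\int[nu]_x (trunc n x)%:E)%E).
    rewrite fineK// ge0_fin_numE ?int_ge0//.
    by apply: le_lt_trans (ltry (v + n%:R)); rewrite e2 leeDl// int_ge0.
  have [nn nnE] : exists r : R, (\int[nu]_x (negn n x)%:E = r%:E)%E.
    exists (fine (\int[nu]_x (negn n x)%:E)%E).
    rewrite fineK// ge0_fin_numE ?int_ge0//.
    by apply: le_lt_trans (ltry (v + n%:R)); rewrite e2 leeDr// int_ge0.
  rewrite ntE nnE -EFinD in e2; rewrite ntE in le_trunc; rewrite nnE.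
  move: e2 => [e2].
  rewrite -(leeD2rE (x := n%:R%:E))// addeAC e1.
  apply: le_trans (_ : (nt%:E + a%:E + nn%:E <= _)%E).
    by rewrite leeD2r// leeD.
  by rewrite -!EFinD lee_fin; lra.
(* The case [n = 0] of [key] gives finiteness under [mu] as well. *)
have [w wE] : exists w : R, (\int[mu]_x (pos x)%:E = w%:E)%E.
  exists (fine (\int[mu]_x (pos x)%:E)%E); rewrite fineK// ge0_fin_numE ?int_ge0//.
  apply: le_lt_trans (ltry (v + a)); apply: le_trans (key 0%N).
  by rewrite leeDl// int_ge0.
have negn_le n : (\int[nu]_x (negn n x)%:E <= (v + a - w)%:E)%E.
  by rewrite -(leeD2lE (x := w%:E))// -wE (le_trans (key n))// wE -EFinD lee_fin; lra.
have lim_negn x : limn (fun n => (negn n x)%:E) = (neg x)%:E.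
  apply/cvg_lim => //; apply: cvg_near_cst; near=> n.
  by rewrite /negn min_l//; near: n; exact: nbhs_infty_ger.
have negn_homo x m n : (m <= n)%N -> ((negn m x)%:E <= (negn n x)%:E)%E.
  by move=> mn; rewrite lee_fin le_min !ge_min lexx /= ler_nat mn orbT.
have cneg := @cvg_monotone_convergence _ _ _ nu setT measurableT
  (fun n x => (negn n x)%:E) mnegn (fun n x _ => negn0 n x) (fun x _ => negn_homo x).
rewrite wE vE -!EFinB lee_fin.
(* As [n] grows the truncated negative parts increase to [neg], so their bound passes to [b]. *)
suff : (b%:E <= (v + a - w)%:E)%E by rewrite lee_fin; lra.
rewrite -bE -(eq_integral _ _ (fun x _ => lim_negn x)).
rewrite -(cvg_lim _ cneg)//.
by apply: lime_le; [exact: cvgP cneg|exact: nearW].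
Unshelve. all: by end_near. Qed.

End strassen_from_lipschitz.

(** * Convex order *)

(** With this test function, [dirichlet_mean_law_lip_convex] shows that Dirichlet means have a
    mean. *)
Lemma lip_convex_norm (R : realType) (d : nat) :
  lip_convex 1 (fun x : 'rV[R]_d => `|x|).
Proof.
split => // [x y|x y p /andP[p0 p1]].
  by rewrite mul1r addrC -lerBlDr lerB_dist.
apply: le_trans (ler_normD _ _) _.
by rewrite !normrZ !ger0_norm// subr_ge0.
Qed.

Lemma dirichlet_mean_law_lip_convex (R : realType) (d : nat)
    (alpha : probability 'rV[R]_d R) (t : R) (mu : probability 'rV[R]_d R) :
  (\int[alpha]_b `|b|%:E < +oo)%E -> 0 < t -> is_dirichlet_mean_law alpha t mu ->
  exists2 beta : probability R R,
    forall A, measurable A -> beta A = beta1 t A &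
    forall (G : 'rV[R]_d -> R) L, lip_convex L G ->
      (\int[mu]_x (G x)%:E < +oo)%E /\
      ((iter n (step_op (alpha \x beta)%E) G 0)%:E @[n --> \oo] -->
        \int[mu]_x (G x)%:E)%E.
Proof.
move=> alpha_mean t0 [disp [T [P [B [Y [X [[lawB lawY indBY cvgX] lawX]]]]]]].
(* [beta1 t] is a bare set function; the law of [Y 0] is a probability with the same values on
   measurable sets. *)
pose beta : probability R R := distribution P (Y 0%N).
have betaE A : measurable A -> beta A = beta1 t A by move=> mA; rewrite -(lawY 0%N).
exists beta => // G L GL; have [L0 G0 _ _] := GL.
have lawY' n : has_law (Y n) beta by move=> A mA; rewrite lawY// betaE.
have [rho rho1 rhoE] := beta1_contraction t0 betaE.
have [iG cG] := lip_convex_mean_cvg lawB lawY' indBY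
  (beta1_step_mean alpha_mean t0 betaE) (beta1_step_contraction alpha rhoE) rho1
  cvgX GL.
have mG : measurable_fun setT (fun x => (G x)%:E).
  by apply/measurable_EFinP; exact: measurable_lip_convex GL.
have <- : (\int[P]_w (G (X w))%:E = \int[mu]_x (G x)%:E)%E.
  transitivity (\int[distribution P X]_x (G x)%:E)%E.
    by rewrite ge0_integral_distribution// => x; rewrite lee_fin.
  by apply: eq_measure_integral => A mA _; rewrite /= -lawX.
split=> //; move/integrableP : iG => [_]; apply: le_lt_trans.
by rewrite le_eqVlt; apply/orP; left; apply/eqP; apply: eq_integral => w _;
  rewrite gee0_abs ?lee_fin.
Qed.

Section comparison.
Context (R : realType) (d : nat) (alpha : probability 'rV[R]_d R) (s t : R)
  (mu_s mu_t : probability 'rV[R]_d R).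
Hypotheses (alpha_mean : (\int[alpha]_b `|b|%:E < +oo)%E) (s0 : 0 < s)
  (st : s <= t) (mu_sP : is_dirichlet_mean_law alpha s mu_s)
  (mu_tP : is_dirichlet_mean_law alpha t mu_t).

Lemma dirichlet_mean_lip_convex_le (G : 'rV[R]_d -> R) L : lip_convex L G ->
  (\int[mu_t]_x (G x)%:E <= \int[mu_s]_x (G x)%:E)%E.
Proof.
move=> GL; have t0 : 0 < t := lt_le_trans s0 st.
have [beta_s bs Hs] := dirichlet_mean_law_lip_convex alpha_mean s0 mu_sP.
have [beta_t bt Ht] := dirichlet_mean_law_lip_convex alpha_mean t0 mu_tP.
pose gam_s : probability ('rV[R]_d * R)%type R := (alpha \x beta_s)%E.
pose gam_t : probability ('rV[R]_d * R)%type R := (alpha \x beta_t)%E.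
have ms : (\int[mu_s]_x `|x|%:E < +oo)%E by have [] := Hs _ _ (@lip_convex_norm R d).
have [rs _ /(beta1_step_contraction alpha) rsE] := beta1_contraction s0 bs.
have [rt rt1 /(beta1_step_contraction alpha) rtE] := beta1_contraction t0 bt.
have gms := beta1_step_mean alpha_mean s0 bs.
have gmt := beta1_step_mean alpha_mean t0 bt.
(* Iterating from [step_op gam_s F] shifts the sequence of iterates of [F] by one, so both have the
   same limit; these limits are the two integrals. *)
have stationary F K : lip_convex K F ->
    (\int[mu_s]_x (step_op gam_s F x)%:E = \int[mu_s]_x (F x)%:E)%E.
  move=> FK; have [_ c1] := Hs _ _ FK.
  have [_ c2] := Hs _ _ (lip_convex_step_op gms rsE FK).
  apply: (cvg_unique _ c2) => //.
  pose u n := (iter n (step_op gam_s) F 0)%:E.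
  have uS : [sequence u n.+1]_n =
      (fun n => (iter n (step_op gam_s) (step_op gam_s F) 0)%:E).
    by apply/funext => n; rewrite /u /= -iterSr.
  by move: c1; rewrite -(cvg_shiftS u) uS.
(* Each iterate is again Lipschitz and convex, so the one-step inequality applies to it. *)
have decrease F K n : lip_convex K F ->
    (\int[mu_s]_x (iter n (step_op gam_t) F x)%:E <= \int[mu_s]_x (F x)%:E)%E.
  move=> FK; elim: n => // n IH; apply: le_trans IH.
  have FKn := lip_convex_iter_step_op gmt rtE n FK.
  exact: (integral_step_op_le alpha_mean ms FKn s0 st bs bt (stationary _ _ FKn)).
have [L0 G0 _ _] := GL.
pose m := fine (\int[mu_s]_x `|x|%:E)%E.
have mE : (\int[mu_s]_x `|x|%:E = m%:E)%E.
  by rewrite /m fineK// ge0_fin_numE//; apply: integral_ge0.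
pose g := fine (\int[mu_s]_x (G x)%:E)%E.
have gE : (\int[mu_s]_x (G x)%:E = g%:E)%E.
  rewrite /g fineK// ge0_fin_numE; first by have [] := Hs _ _ GL.
  by apply: integral_ge0 => x _; rewrite lee_fin.
(* The value at 0 of the [n]-th iterate is compared with its mean under [mu_s]: its Lipschitz
   constant is [L * rt ^+ n], so the error is at most [L * m * rt ^+ n], which tends to 0. *)
have bound n : iter n (step_op gam_t) G 0 <= g + geometric (L * m) rt n.
  have [Ln0 Gn0 Gnlip _] := lip_convex_iter_step_op gmt rtE n GL.
  have mGn : measurable_fun setT (fun x => (iter n (step_op gam_t) G x)%:E).
    apply/measurable_EFinP.
    exact: measurable_lip_convex (lip_convex_iter_step_op gmt rtE n GL).
  have mn : measurable_fun setT (fun x : 'rV[R]_d => `|x|%:E).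
    by apply/measurable_EFinP; exact: measurable_normrV.
  rewrite -lee_fin EFinD -gE.
  apply: le_trans (leeD (decrease _ _ n GL) (lexx _)).
  rewrite /= mulrAC EFinM -mE -ge0_integralZl_EFin//.
  rewrite -ge0_integralD//; last 3 first.
  - by move=> x _; rewrite lee_fin.
  - by move=> x _; rewrite -EFinM lee_fin mulr_ge0.
  - exact: measurable_funeM.
  rewrite -[leLHS]mule1 -(probability_setT mu_s) -integral_cst//.
  apply: ge0_le_integral => //.
  - by move=> x _; rewrite lee_fin.
  - by apply: emeasurable_funD => //; exact: measurable_funeM.
  - move=> x _; rewrite -EFinM -EFinD lee_fin.
    by have := Gnlip 0 x; rewrite sub0r normrN.
have [_ cG] := Ht _ _ GL.
rewrite gE -(cvg_lim _ cG)//.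
have cb : (g + geometric (L * m) rt n)%:E @[n --> \oo] --> g%:E.
  apply: cvg_EFin; first exact: nearW.
  rewrite -[X in _ --> X]addr0; apply: cvgD; first exact: cvg_cst.
  by apply: cvg_geometric; rewrite ger0_norm ?(rho_ge0 rtE).
rewrite -(cvg_lim _ cb)//; apply: lee_lim.
- exact: cvgP cG.
- exact: cvgP cb.
- by apply: nearW => n; rewrite lee_fin; exact: bound.
Qed.

End comparison.

Lemma has_mean_norm (R : realType) (d : nat) (mu : probability 'rV[R]_d R) :
  has_mean mu <-> (\int[mu]_x `|x|%:E < +oo)%E.
Proof.
have mn : measurable_fun setT (fun x : 'rV[R]_d => `|x|%:E).
  by apply/measurable_EFinP; exact: measurable_normrV.
have me : measurable_fun setT (fun x : 'rV[R]_d => (enorm x)%:E).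
  by apply/measurable_EFinP; exact: measurable_enorm.
rewrite /has_mean; split=> [|mu_fin].
  apply: le_lt_trans; apply: ge0_le_integral => // x _.
  by rewrite lee_fin norm_le_enorm.
apply: (@le_lt_trans _ _ (\int[mu]_x (d%:R%:E * `|x|%:E))%E).
  apply: ge0_le_integral => // [x _||x _].
  - by rewrite lee_fin sqrtr_ge0.
  - exact: measurable_funeM.
  - by rewrite -EFinM lee_fin enorm_le_norm.
by rewrite ge0_integralZl_EFin// lte_mul_pinfty.
Qed.

Theorem theorem1p1 (R : realType) (d : nat) (alpha : probability 'rV[R]_d R)
    (alpha_mean : (\int[alpha]_x (enorm x)%:E < +oo)%E)
    (s t : R) (s_gt0 : 0 < s) (s_le_t : s <= t)
    (mu_s mu_t : probability 'rV[R]_d R)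
    (mu_sP : is_dirichlet_mean_law alpha s mu_s)
    (mu_tP : is_dirichlet_mean_law alpha t mu_t) :
  (forall psi : 'rV[R]_d -> R, convexRd psi ->
     (\int[mu_t]_x (psi x)%:E <= \int[mu_s]_x (psi x)%:E)%E) /\
  strassen_le mu_t mu_s.
Proof.
have norm_mean := (has_mean_norm alpha).1 alpha_mean.
have mean_of r mu : 0 < r -> is_dirichlet_mean_law alpha r mu ->
    (\int[mu]_x `|x|%:E < +oo)%E.
  move=> r0 /(dirichlet_mean_law_lip_convex norm_mean r0)[beta _].
  by move=> /(_ _ _ (@lip_convex_norm R d))[].
have mean_s := mean_of s mu_s s_gt0 mu_sP.
have mean_t := mean_of t mu_t (lt_le_trans s_gt0 s_le_t) mu_tP.
have le_psi (psi : 'rV[R]_d -> R) : convexRd psi ->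
    (\int[mu_t]_x (psi x)%:E <= \int[mu_s]_x (psi x)%:E)%E.
  move=> /convexRd_le; apply: convex_integral_le => // G L.
  exact: (dirichlet_mean_lip_convex_le norm_mean s_gt0 s_le_t mu_sP mu_tP).
by split=> //; split=> //; apply/has_mean_norm.
Qed.
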